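(* Consider the linear time-varying plant $x_{t+1}=A_tx_t+B_{u,t}u_t+B_{w,t}w_t$, $t=0,\ldots,T-1$, with cost $$J_T(K,w,x_0)=x_T^\top Q_Tx_T+\sum_{t=0}^{T-1}\big(x_t^\top Q_tx_t+u_t^\top R_tu_t\big),$$ where $Q_t\succeq 0$ for $t=0,\ldots,T$ and $R_t\succ 0$ for $t=0,\ldots,T-1$, and the finite-horizon stochastic LQR problem with $p\ge 0$ steps of disturbance preview $$J^*_{T,p}(i_0):=\min_K\mathbb{E}\big[J_T(K,w,x_0)\mid i_0\big],$$ where the minimum is over sequences of (possibly randomized) policies $K=\{K_0,\ldots,K_{T-1}\}$, with $K_t$ using the information $i_t$. Define $P_T:=Q_T$ and, backwards for $t=T-1,\ldots,0$, $$H_t:=R_t+B_{u,t}^\top P_{t+1}B_{u,t},\qquad P_t:=Q_t+A_t^\top P_{t+1}A_t-A_t^\top P_{t+1}B_{u,t}H_t^{-1}B_{u,t}^\top P_{t+1}A_t,$$ and the gains $$K_{x,t}:=H_t^{-1}B_{u,t}^\top P_{t+1}A_t,\qquad K_{w,t}:=H_t^{-1}B_{u,t}^\top P_{t+1}B_{w,t},\qquad K_{v,t}:=H_t^{-1}B_{u,t}^\top .$$ Then the sequence of policies that achieves $J^*_{T,p}(i_0)$ is deterministic and has the form $$u_t^*=-K_{x,t}x_t-K_{w,t}w_t-K_{v,t}v_{t+1},$$ where $v_{t+1}$ depends on $\{w_{t+1},\ldots,w_{t+p}\}$ and is given by $$v_{t+1}=\sum_{j=t+1}^{t+p}\big[\hat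 A_{t+1}^\top\hat A_{t+2}^\top\cdots\hat A_j^\top\big]P_{j+1}B_{w,j}w_j,\qquad \hat A_j:=A_j-B_{u,j}K_{x,j},$$ with the convention that $w_j=0$ (so the corresponding term vanishes) when $j\ge T$.
   Context: Here $T<\infty$, $x_t\in\mathbb{R}^{n_x}$, $u_t\in\mathbb{R}^{n_u}$, $w_t\in\mathbb{R}^{n_w}$ are the state, input and disturbance, and $A_t,B_{u,t},B_{w,t}$ are real matrices of compatible dimensions for $t=0,\ldots,T-1$. $Q_t$ and $R_t$ are real symmetric matrices; $\succeq 0$ and $\succ 0$ denote positive semidefinite and positive definite. The disturbance is independent and identically distributed (IID) noise with $\mathbb{E}[w_i]=0$ and $\mathbb{E}[w_iw_j^\top]=\delta_{ij}I$ for $i,j\in\{0,\ldots,T-1\}$. The initial condition $x_0$ may be non-zero. The information available to the controller at time $t$ is $$i_t:=\{x_0,\ldots,x_t,w_0,\ldots,w_{t+p}\}\ \text{ if } t\le T-p-1,\qquad i_t:=\{x_0,\ldots,x_t,w_0,\ldots,w_{T-1}\}\ \text{ otherwise},$$ where the integer $p\ge 0$ is the preview length. A policy at time $t$ is a conditional probability density over actions given the information, $K_t(u_t,i_t):=\mathrm{Prob}(u_t\mid i_t)$; deterministic policies $u_t=k_t(i_t)$ are a special case. *)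

(* Defs.v *)
From HB Require Import structures.
From mathcomp Require Import all_boot all_order all_algebra.
From mathcomp Require Import all_classical all_reals all_analysis.
From mathcomp Require Import measurable_realfun.

Set Implicit Arguments.
Unset Strict Implicit.
Unset Printing Implicit Defensive.
Import Order.TTheory GRing.Theory Num.Theory.

Local Open Scope classical_set_scope.
Local Open Scope ring_scope.

Definition measure_matrix_display : measure_display -> measure_display.
Proof. exact. Qed.

(* The product sigma-algebra, generated by the entries; over the reals this is
   the Borel sigma-algebra of the finite-dimensional space of matrices. *)
Section measurable_matrix.
Context {d} {T : sigmaRingType d}.
Variables m n : nat.

Definition matrix_measurable : set (set 'M[T]_(m, n)) :=
  <<s [set A | exists i j, exists2 B, measurable B &
                 A = [set M : 'M[T]_(m, n) | B (M i j)]] >>.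

Let matrix_measurable0 : matrix_measurable set0.
Proof. exact: sigma_algebra0. Qed.

Let matrix_measurableC A :
  matrix_measurable A -> matrix_measurable (~` A).
Proof. exact: sigma_algebraC. Qed.

Let matrix_measurable_bigcup (F : _^nat) :
  (forall i, matrix_measurable (F i)) -> matrix_measurable (\bigcup_i (F i)).
Proof. exact: sigma_algebra_bigcup. Qed.

HB.instance Definition _ := @isMeasurable.Build (measure_matrix_display d)
  'M[T]_(m, n) matrix_measurable
  matrix_measurable0 matrix_measurableC matrix_measurable_bigcup.

End measurable_matrix.

Section noise.
Context d (Omega : measurableType d) (R : realType) (P : probability Omega R).
Variables (n : nat) (T : nat) (w : nat -> {RV P >-> 'cV[R]_n}).

(* The product rule for subfamilies is the case where some A i are setT. *)
Definition mutually_independent : Prop :=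
  forall A : nat -> set 'cV[R]_n, (forall i, measurable (A i)) ->
    P (\bigcap_(i in `I_T) (w i @^-1` A i)) =
    (\prod_(i < T) P (w i @^-1` A i))%E.

Definition identically_distributed : Prop :=
  forall i j, (i < T)%N -> (j < T)%N -> forall A, measurable A ->
    P (w i @^-1` A) = P (w j @^-1` A).

Definition iid : Prop := mutually_independent /\ identically_distributed.

(* Entrywise E[w_i] = 0 and E[w_i w_j^T] = delta_ij I.  With the library's
   convention +oo - +oo = -oo, a finite value of 'E_P[X] forces X to be
   integrable. *)
Definition zero_mean : Prop :=
  forall i, (i < T)%N -> forall k, ('E_P[fun omega => (w i omega k 0)%R] = 0)%E.

Definition identity_covariance : Prop :=
  forall i j, (i < T)%N -> (j < T)%N -> forall k l,
    ('E_P[fun omega => (w i omega *m (w j omega)^T) k l] =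
      ((i == j)%:R * (1%:M : 'M[R]_n) k l)%:E)%E.

End noise.

Section quadratic_forms.
Variables (R : realType) (n : nat).

Definition quad (M : 'M[R]_n) (x : 'cV[R]_n) : R := (x^T *m M *m x) 0 0.

Definition sym_psd (M : 'M[R]_n) : Prop := M^T = M /\ forall x, 0 <= quad M x.

Definition sym_pd (M : 'M[R]_n) : Prop :=
  M^T = M /\ forall x, x != 0 -> 0 < quad M x.

End quadratic_forms.

(* Only the entries at times t < T are meaningful (t <= T for lq_Q). *)
Record lq_data (R : realType) (nx nu nw : nat) := LQData {
  lq_A : nat -> 'M[R]_nx;
  lq_Bu : nat -> 'M[R]_(nx, nu);
  lq_Bw : nat -> 'M[R]_(nx, nw);
  lq_Q : nat -> 'M[R]_nx;
  lq_R : nat -> 'M[R]_nu }.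

Section problem.
Variables (R : realType) (nx nu nw : nat).
Variables (D : lq_data R nx nu nw) (T p : nat).

Local Notation A := (lq_A D).
Local Notation Bu := (lq_Bu D).
Local Notation Bw := (lq_Bw D).
Local Notation Q := (lq_Q D).
Local Notation Rw := (lq_R D).

Fixpoint state (x0 : 'cV[R]_nx) (w : nat -> 'cV[R]_nw) (u : nat -> 'cV[R]_nu)
    (t : nat) : 'cV[R]_nx :=
  if t is s.+1 then A s *m state x0 w u s + Bu s *m u s + Bw s *m w s else x0.

Definition cost (x0 : 'cV[R]_nx) (w : nat -> 'cV[R]_nw)
    (u : nat -> 'cV[R]_nu) : R :=
  quad (Q T) (state x0 w u T) +
  \sum_(t < T) (quad (Q t) (state x0 w u t) + quad (Rw t) (u t)).

(* i_t = (x_0, ..., x_t ; w_0, ..., w_min(t+p, T-1)). *)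
Definition info (t : nat) : Type :=
  (t.+1.-tuple 'cV[R]_nx * (minn (t + p).+1 T).-tuple 'cV[R]_nw)%type.
HB.instance Definition _ t := Measurable.on (info t).

Definition info_at (x0 : 'cV[R]_nx) (w : nat -> 'cV[R]_nw)
    (u : nat -> 'cV[R]_nu) (t : nat) : info t :=
  ([tuple state x0 w u i | i < t.+1], [tuple w i | i < minn (t + p).+1 T]).

Definition policy := forall t : nat, R.-pker (info t) ~> 'cV[R]_nu.

(* Integrates F over the actions u_t, ..., u_{t+k-1}, drawn successively with
   u_s ~ K_s(. | i_s), the earlier actions being those of u and the disturbance
   path w being fixed. *)
Fixpoint draw_actions (K : policy) (x0 : 'cV[R]_nx) (w : nat -> 'cV[R]_nw)
    (F : (nat -> 'cV[R]_nu) -> \bar R) (k t : nat) (u : nat -> 'cV[R]_nu) :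
    \bar R :=
  if k is k'.+1 then
    (\int[K t (info_at x0 w u t)]_a
       draw_actions K x0 w F k' t.+1 (fun s => if s == t then a else u s))%E
  else F u.

Section stochastic.
Context d (Omega : measurableType d) (P : probability Omega R).
Variables (w : nat -> {RV P >-> 'cV[R]_nw}) (x0 : 'cV[R]_nx).

Definition noise_path (omega : Omega) : nat -> 'cV[R]_nw := fun t => w t omega.

(* Expectation under the joint law of the disturbances and of the actions
   generated by the policy K in closed loop. *)
Definition policy_expectation (K : policy)
    (F : Omega -> (nat -> 'cV[R]_nu) -> \bar R) : \bar R :=
  (\int[P]_omega draw_actions K x0 (noise_path omega) (F omega) T 0
     (fun=> 0%R))%E.

(* sigma(i_0); i_0 involves no action, so the input sequence is irrelevant. *)
Definition info0_measurable : set (set Omega) :=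
  preimage_set_system setT
    (fun omega => info_at x0 (noise_path omega) (fun=> 0) 0) measurable.

(* g is a version of E[J_T(K, w, x_0) | i_0]. *)
Definition is_conditional_cost (K : policy) (g : Omega -> \bar R) : Prop :=
  (forall B : set (\bar R), measurable B -> info0_measurable (g @^-1` B)) /\
  (forall E, info0_measurable E ->
    (\int[P]_(omega in E) g omega =
     policy_expectation K
       (fun omega u => (\1_E omega * cost x0 (noise_path omega) u)%R%:E))%E).

(* g is a version of J^*_{T,p}(i_0) = min_K E[J_T(K, w, x_0) | i_0]. *)
Definition is_optimal_cost (g : Omega -> \bar R) : Prop :=
  (exists K, is_conditional_cost K g) /\
  (forall K h, is_conditional_cost K h ->
    {ae P, forall omega, (g omega <= h omega)%E}).

Definition optimal_policy (K : policy) : Prop :=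
  exists2 g, is_optimal_cost g & is_conditional_cost K g.

End stochastic.

Definition gram (t : nat) (S : 'M[R]_nx) : 'M[R]_nu :=
  Rw t + (Bu t)^T *m S *m Bu t.

(* riccati_iter k = P_{T-k}. *)
Fixpoint riccati_iter (k : nat) : 'M[R]_nx :=
  if k is k'.+1 then
    let t := (T - k'.+1)%N in
    let S := riccati_iter k' in
    Q t + (A t)^T *m S *m A t
    - (A t)^T *m S *m Bu t *m invmx (gram t S) *m (Bu t)^T *m S *m A t
  else Q T.

Definition riccati (t : nat) : 'M[R]_nx := riccati_iter (T - t).

Definition Hmx (t : nat) : 'M[R]_nu := gram t (riccati t.+1).

Lemma riccatiT : riccati T = Q T.
Proof. by rewrite /riccati subnn. Qed.

Lemma riccatiE t : (t < T)%N ->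
  riccati t = Q t + (A t)^T *m riccati t.+1 *m A t
    - (A t)^T *m riccati t.+1 *m Bu t *m invmx (Hmx t)
        *m (Bu t)^T *m riccati t.+1 *m A t.
Proof.
move=> tT; rewrite /Hmx {1}/riccati -(subnSK tT) /= -/(riccati t.+1).
by rewrite subnSK // subKn // ltnW.
Qed.

Definition gain_x (t : nat) : 'M[R]_(nu, nx) :=
  invmx (Hmx t) *m (Bu t)^T *m riccati t.+1 *m A t.

Definition gain_w (t : nat) : 'M[R]_(nu, nw) :=
  invmx (Hmx t) *m (Bu t)^T *m riccati t.+1 *m Bw t.

Definition gain_v (t : nat) : 'M[R]_(nu, nx) := invmx (Hmx t) *m (Bu t)^T.

Definition Ahat (t : nat) : 'M[R]_nx := A t - Bu t *m gain_x t.

(* w_j as read off i_t: for j <= t + p, index j is out of range exactly when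
   j >= T, and the default value 0 is then the convention w_j = 0. *)
Definition info_w (t : nat) (i : info t) (j : nat) : 'cV[R]_nw := nth 0 i.2 j.

Definition info_x (t : nat) (i : info t) : 'cV[R]_nx := tnth i.1 ord_max.

(* v_{t+1}; \prod is the ordered product of matrices. *)
Definition preview_v (t : nat) (i : info t) : 'cV[R]_nx :=
  \sum_(t.+1 <= j < (t + p).+1)
    (\prod_(t.+1 <= l < j.+1) (Ahat l)^T)
      *m riccati j.+1 *m Bw j *m info_w i j.

Definition lqr_action (t : nat) (i : info t) : 'cV[R]_nu :=
  - (gain_x t *m info_x i) - gain_w t *m info_w i t - gain_v t *m preview_v i.

End problem.

(* Main.v *)
(* Completing the square backwards in time along a fixed disturbance path gives
   cost = V(w) + sum_t |u_t - u*_t|^2_{H_t} + 2 sum_t <u_t - u*_t, Bu_t^T e_t>,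
   where u* is the claimed policy and e_t is the part of the full co-state that
   involves w_j with j > t + p only.  Under any policy, the actions up to time t
   are independent of such w_j, which have mean zero, so the cross term has
   expectation zero, also when restricted to an event of sigma(i_0).  This needs
   u_t to be square integrable, which follows from R_t > 0 as soon as the cost
   has finite expectation.  Hence E[cost; E] >= E[V; E] for all E in sigma(i_0),
   with equality for u*; integrating over all of the sample space, equality
   forces u_t = u*_t almost surely since H_t > 0.  The optimal conditional cost
   E[V | i_0] is a Radon-Nikodym derivative on the space of values of i_0. *)
Require Import Defs.
From HB Require Import structures.
From mathcomp Require Import all_boot all_order all_algebra.
From mathcomp Require Import all_classical all_reals all_analysis.
From mathcomp Require Import measurable_realfun.
From mathcomp Require Import ring lra.

Set Implicit Arguments.
Unset Strict Implicit.
Unset Printing Implicit Defensive.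
Import Order.TTheory GRing.Theory Num.Theory.

Local Open Scope classical_set_scope.
Local Open Scope ring_scope.

(** * Completing the square *)

Section dot_product.
Variable R : realType.
Implicit Types m n : nat.

(** Expectations under a policy are iterated kernel integrals, convenient for nonnegative
    integrands, whereas the cross term is signed. The draws are therefore realised on one
    probability space [Z], with a map [f] to [Omega] and a random action sequence [v], where
    integrals are linear. The transfer from [policy_expectation] is proved for nonnegative
    integrands, so signed quantities reach it through positive and negative parts. A competing
    policy may have infinite cost. Finiteness is available at best on the event of sigma(i_0) at
    hand, so integrability of inputs, states and deviations is stated after multiplication by the
    indicator [chi] of that event. Versions of conditional costs take extended real values and come
    without integrability; they are compared with one explicit finite-valued version built from
    V. *)

Definition dot n (x y : 'cV[R]_n) : R := (x^T *m y) 0 0.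

Lemma dotE n (x y : 'cV[R]_n) : dot x y = \sum_k x k 0 * y k 0.
Proof. by rewrite /dot mxE; apply: eq_bigr => k _; rewrite mxE. Qed.

Lemma dotC n (x y : 'cV[R]_n) : dot x y = dot y x.
Proof. by rewrite !dotE; apply: eq_bigr => k _; rewrite mulrC. Qed.

Lemma dotDr n (x y z : 'cV[R]_n) : dot x (y + z) = dot x y + dot x z.
Proof. by rewrite /dot mulmxDr mxE. Qed.

Lemma dotDl n (x y z : 'cV[R]_n) : dot (y + z) x = dot y x + dot z x.
Proof. by rewrite dotC dotDr !(dotC x). Qed.

Lemma dotNr n (x y : 'cV[R]_n) : dot x (- y) = - dot x y.
Proof. by rewrite /dot mulmxN mxE. Qed.

Lemma dotZr n a (x y : 'cV[R]_n) : dot x (a *: y) = a * dot x y.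
Proof. by rewrite /dot -scalemxAr mxE. Qed.

Lemma dotZl n a (x y : 'cV[R]_n) : dot (a *: y) x = a * dot y x.
Proof. by rewrite dotC dotZr dotC. Qed.

Lemma dot0r n (x : 'cV[R]_n) : dot x 0 = 0.
Proof. by rewrite /dot mulmx0 mxE. Qed.

Lemma dot_mulmxl m n (A : 'M[R]_(m, n)) x y :
  dot (A *m x) y = dot x (A^T *m y).
Proof. by rewrite /dot trmx_mul mulmxA. Qed.

Lemma quadE n (M : 'M[R]_n) x : quad M x = dot x (M *m x).
Proof. by rewrite /quad /dot mulmxA. Qed.

Lemma quad0 n (M : 'M[R]_n) : quad M 0 = 0.
Proof. by rewrite quadE mulmx0 dot0r. Qed.

Lemma quadDm n (M N : 'M[R]_n) x : quad (M + N) x = quad M x + quad N x.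
Proof. by rewrite !quadE mulmxDl dotDr. Qed.

Lemma quad_conj m n (M : 'M[R]_m) (B : 'M[R]_(m, n)) x :
  quad (B^T *m M *m B) x = quad M (B *m x).
Proof. by rewrite !quadE dot_mulmxl !mulmxA. Qed.

Lemma quadD n (M : 'M[R]_n) x y : M^T = M ->
  quad M (x + y) = quad M x + dot x (M *m y) *+ 2 + quad M y.
Proof.
move=> Msym; rewrite !quadE mulmxDr !dotDr !dotDl.
rewrite [dot y (M *m x)]dotC dot_mulmxl Msym mulr2n; ring.
Qed.

Lemma sym_pd_unit n (M : 'M[R]_n) : sym_pd M -> M \in unitmx.
Proof.
move=> [Msym Mpos]; rewrite -row_free_unit -kermx_eq0.
apply/negP => /negP /rowV0Pn [v] /sub_kermxP vM v0.
have vT0 : v^T != 0 by rewrite -trmx0 (inj_eq trmx_inj).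
have := Mpos _ vT0; rewrite quadE.
have -> : M *m v^T = 0 by rewrite -[LHS]trmxK trmx_mul trmxK Msym vM trmx0.
by rewrite dot0r ltxx.
Qed.

Lemma sym_pd_psd n (M : 'M[R]_n) : sym_pd M -> sym_psd M.
Proof.
move=> [Msym Mpos]; split=> // x; have [->|/Mpos/ltW//] := eqVneq x 0.
by rewrite quad0.
Qed.

(** Positivity of the form at -b x + a y reads a (a c - b^2) >= 0. As [M] is only semidefinite, a =
    0 is possible, and b = 0 must then come from other combinations. *)
Lemma quad_cauchy_schwarz n (M : 'M[R]_n) x y : sym_psd M ->
  dot x (M *m y) ^+ 2 <= quad M x * quad M y.
Proof.
move=> [Msym M0].
set a := quad M x; set b := dot x (M *m y); set c := quad M y.
have key r s : 0 <= r ^+ 2 * a + (r * s * b) *+ 2 + s ^+ 2 * c.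
  have := M0 (r *: x + s *: y); rewrite quadD // -/a -/c.
  rewrite !quadE -!scalemxAr !dotZl !dotZr -!quadE -/a -/b -/c.
  by rewrite !mulrA -!expr2.
have a0 : 0 <= a := M0 x.
have [a_eq0|a_neq0] := eqVneq a 0.
  (* With a = 0 these give -c b^2 >= 0 and (c - 2) b^2 >= 0; the first forces b = 0 if c > 0, the
     second if c = 0. *)
  have := key c (- b); have := key 1 (- b).
  have : 0 <= c := M0 y.
  rewrite a_eq0 !mulr2n !mulr0 !mul0r !add0r => c0 h1 h2.
  have [c_eq0|c_neq0] := eqVneq c 0; first by move: h1; rewrite c_eq0; nra.
  have c_gt0 : 0 < c by rewrite lt_neqAle eq_sym c_neq0.
  have : 0 <= c * (- b ^+ 2) by move: h2; nra.
  by rewrite pmulr_rge0 // oppr_ge0.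
have := key (- b) a => h.
have : 0 <= a * (a * c - b ^+ 2) by move: h; rewrite mulr2n; nra.
by rewrite pmulr_rge0 ?lt_neqAle 1?eq_sym ?a_neq0// subr_ge0.
Qed.

(* Cauchy-Schwarz for M, as [x k 0] is the M-inner product of [invmx M e_k]
   and x. *)
Lemma quad_pd_coord_le n (M : 'M[R]_n) (x : 'cV[R]_n) k : sym_pd M ->
  x k 0 ^+ 2 <= quad M (invmx M *m delta_mx k 0) * quad M x.
Proof.
move=> Mpd; have [Msym _] := Mpd; have Mu := sym_pd_unit Mpd.
apply: le_trans (quad_cauchy_schwarz _ _ (sym_pd_psd Mpd)).
suff -> : dot (invmx M *m delta_mx k 0) (M *m x) = x k 0 by [].
rewrite dot_mulmxl trmx_inv Msym mulKmx // dotE (bigD1 k) //= mxE !eqxx mul1r.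
by rewrite big1 ?addr0 // => i ik; rewrite mxE (negbTE ik) mul0r.
Qed.

Lemma quad_complete_square n (M : 'M[R]_n) u z : M^T = M -> M \in unitmx ->
  quad M u + dot u z *+ 2 =
  quad M (u + invmx M *m z) - dot z (invmx M *m z).
Proof.
move=> Msym Mu; rewrite quadD // mulKVmx // [quad M (invmx M *m z)]quadE.
by rewrite mulKVmx // [dot (invmx M *m z) z]dotC addrK.
Qed.

End dot_product.

(** * Riccati recursion and pathwise cost decomposition *)

Section lq_algebra.
Variables (R : realType) (nx nu nw : nat) (D : lq_data R nx nu nw) (T p : nat).

Local Notation A := (lq_A D).
Local Notation Bu := (lq_Bu D).
Local Notation Bw := (lq_Bw D).
Local Notation Q := (lq_Q D).
Local Notation Rw := (lq_R D).
Local Notation S := (riccati D T).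
Local Notation H := (Hmx D T).

Hypothesis hQ : forall t, (t <= T)%N -> sym_psd (Q t).
Hypothesis hR : forall t, (t < T)%N -> sym_pd (Rw t).

Lemma gram_sym_pd t (M : 'M[R]_nx) :
  (t < T)%N -> sym_psd M -> sym_pd (gram D t M).
Proof.
move=> /hR[Rsym Rpos] [Msym M0]; split.
  by rewrite /gram raddfD /= Rsym !trmx_mul trmxK Msym mulmxA.
move=> x x0; rewrite /gram quadDm quad_conj.
by rewrite ltr_pwDl // Rpos.
Qed.

(** Minimum over u of the one-step cost from x = 0 when the value at the next state y is y^T P_{t+1}
    y + 2 s^T y and [b] is the disturbance increment. *)
Definition step_const t (b s : 'cV[R]_nx) : R :=
  quad (S t.+1) b + dot s b *+ 2 -
  dot ((Bu t)^T *m (S t.+1 *m b + s))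
      (invmx (H t) *m ((Bu t)^T *m (S t.+1 *m b + s))).

(** One dynamic programming step for a value function with a quadratic and a linear part. Completing
    the square in [u] subtracts the H_t^{-1}-square of g = g1 + g0, with g1 linear in [x] and g0
    free of [x]: the square of g1 is the Riccati correction, the mixed term turns A_t into [Ahat] in
    the linear part, and the square of g0 goes to [step_const]. *)
Lemma riccati_step t (x : 'cV[R]_nx) (u : 'cV[R]_nu) (b s : 'cV[R]_nx) :
  (t < T)%N -> sym_psd (S t.+1) ->
  quad (Q t) x + quad (Rw t) u + quad (S t.+1) (A t *m x + Bu t *m u + b)
    + dot s (A t *m x + Bu t *m u + b) *+ 2 =
  quad (S t) x + dot ((Ahat D T t)^T *m (S t.+1 *m b + s)) x *+ 2
    + step_const t b s
    + quad (H t) (u + gain_x D T t *m x + gain_v D T t *m (S t.+1 *m b + s)).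
Proof.
move=> tT Spsd; have [Ssym _] := Spsd.
have Hpd : sym_pd (H t) := gram_sym_pd tT Spsd.
have [Hsym _] := Hpd; have Hu := sym_pd_unit Hpd.
have HVsym : (invmx (H t))^T = invmx (H t) by rewrite trmx_inv Hsym.
set c := A t *m x + b.
set g := (Bu t)^T *m (S t.+1 *m c + s).
set g0 := (Bu t)^T *m (S t.+1 *m b + s).
set g1 := (Bu t)^T *m S t.+1 *m A t *m x.
have gE : g = g1 + g0.
  by rewrite /g /g1 /g0 /c !mulmxDr !mulmxA !addrA.
have -> : A t *m x + Bu t *m u + b = Bu t *m u + c.
  by rewrite /c addrA [Bu t *m u + _]addrC.
have -> : u + gain_x D T t *m x + gain_v D T t *m (S t.+1 *m b + s) =
          u + invmx (H t) *m g.
  rewrite gE [invmx (H t) *m _]mulmxDr addrA /gain_x /gain_v /g1 /g0.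
  by rewrite !mulmxA.
have e1 : quad (S t.+1) (Bu t *m u + c) = quad (S t.+1) (Bu t *m u)
    + dot u ((Bu t)^T *m (S t.+1 *m c)) *+ 2 + quad (S t.+1) c.
  by rewrite quadD // dot_mulmxl.
have e1' : quad (H t) u = quad (Rw t) u + quad (S t.+1) (Bu t *m u).
  by rewrite /Hmx /gram quadDm quad_conj.
have e2 : dot s (Bu t *m u + c) = dot u ((Bu t)^T *m s) + dot s c.
  by rewrite dotDr [dot s (Bu t *m u)]dotC dot_mulmxl.
have e3 := quad_complete_square u g Hsym Hu.
have e3' : dot u g =
    dot u ((Bu t)^T *m (S t.+1 *m c)) + dot u ((Bu t)^T *m s).
  by rewrite /g mulmxDr dotDr.
have e4 : dot g (invmx (H t) *m g) = dot g1 (invmx (H t) *m g1)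
    + dot g1 (invmx (H t) *m g0) *+ 2 + dot g0 (invmx (H t) *m g0).
  by rewrite -!quadE gE quadD.
have e5 : quad (S t.+1) c = quad (S t.+1) (A t *m x)
    + dot (A t *m x) (S t.+1 *m b) *+ 2 + quad (S t.+1) b.
  by rewrite quadD.
have e6 : dot s c = dot s (A t *m x) + dot s b by rewrite dotDr.
have e7 : quad (S t) x = quad (Q t) x + quad (S t.+1) (A t *m x)
    - dot g1 (invmx (H t) *m g1).
  rewrite -quad_conj !quadE riccatiE // !mulmxDl mulNmx !dotDr dotNr.
  congr (_ + _ - _); rewrite {1}/g1 dot_mulmxl !trmx_mul trmxK Ssym /g1.
  by rewrite !mulmxA.
have e8 : dot ((Ahat D T t)^T *m (S t.+1 *m b + s)) x =
    dot (A t *m x) (S t.+1 *m b) + dot s (A t *m x)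
    - dot g1 (invmx (H t) *m g0).
  rewrite dot_mulmxl trmxK /Ahat mulmxBl dotDr dotNr dotDl.
  rewrite [dot (S t.+1 *m b) _]dotC; congr (_ - _).
  rewrite [RHS]dotC dot_mulmxl HVsym /g0 dot_mulmxl trmxK.
  by rewrite /gain_x /g1 !mulmxA.
rewrite /step_const -/g0 e7 e8 e2 -!addrA e1.
move: e3; rewrite e3' e1' e4 e5 e6.
rewrite !mulr2n; lra.
Qed.

Lemma riccati_sym t : (t <= T)%N -> (S t)^T = S t.
Proof.
move=> tT; rewrite -(subKn tT); elim: (T - t)%N (leq_subr t T) => [|k IH] kT.
  by rewrite subn0 riccatiT; have [] := hQ (leqnn T).
have tlt : (T - k.+1 < T)%N by rewrite ltn_subLR // addSn ltnS leq_addl.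
have eS : (T - k.+1).+1 = (T - k)%N by rewrite subnSK.
have Ssym : (S (T - k)%N)^T = S (T - k)%N := IH (ltnW kT).
have [Qsym _] := hQ (ltnW tlt).
have [Rsym _] := hR tlt.
have Hsym : (H (T - k.+1))^T = H (T - k.+1)%N.
  by rewrite /Hmx /gram eS raddfD /= Rsym !trmx_mul trmxK Ssym mulmxA.
rewrite riccatiE // !raddfD /= raddfN /= !trmx_mul !trmxK trmx_inv Hsym eS Ssym.
by rewrite Qsym !mulmxA.
Qed.

(** For b = s = 0 and the input -K_x x, the square and the constant in [riccati_step] vanish,
    leaving P_t as a sum of values of the nonnegative forms Q_t, R_t and P_{t+1}. *)
Lemma riccati_psd t : (t <= T)%N -> sym_psd (S t).
Proof.
move=> tT; rewrite -(subKn tT); elim: (T - t)%N (leq_subr t T) => [|k IH] kT.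
  by rewrite subn0 riccatiT; exact: hQ.
split; first by apply: riccati_sym; exact: leq_subr.
have tlt : (T - k.+1 < T)%N by rewrite ltn_subLR // addSn ltnS leq_addl.
have eS : (T - k.+1).+1 = (T - k)%N by rewrite subnSK.
move: (IH (ltnW kT)); rewrite -eS; set t' := (T - k.+1)%N in tlt * => Spsd x.
pose u := - (gain_x D T t' *m x).
have := @riccati_step t' x u 0 0 tlt Spsd.
rewrite /step_const !(mulmx0, addr0, dot0r, quad0, mul0rn, subr0).
rewrite /u addNr quad0 addr0 [dot 0 _]dotC dot0r [dot 0 x]dotC dot0r !mul0rn.
rewrite !addr0 => <-.
rewrite !addr_ge0 //; first by have [_] := hQ (ltnW tlt); apply.
  by have [_] := sym_pd_psd (hR tlt); apply.
by have [_] := Spsd; apply.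
Qed.

Lemma Hmx_pd t : (t < T)%N -> sym_pd (H t).
Proof. by move=> tT; exact: gram_sym_pd (riccati_psd tT). Qed.

(* The preview term [v_t] when the whole disturbance path is known. *)
Definition costate (w : nat -> 'cV[R]_nw) (t : nat) : 'cV[R]_nx :=
  \sum_(t <= j < T)
    (\prod_(t <= l < j.+1) (Ahat D T l)^T) *m S j.+1 *m Bw j *m w j.

(** The right side is the linear coefficient produced by [riccati_step] for b = B_{w,t} w_t and s
    the co-state at t + 1, which lets the recursion over time close. *)
Lemma costateE w t : (t < T)%N ->
  costate w t =
  (Ahat D T t)^T *m (S t.+1 *m (Bw t *m w t) + costate w t.+1).
Proof.
move=> tT; rewrite /costate big_ltn // big_nat1 mulmxDr !mulmxA; congr (_ + _).
rewrite mulmx_sumr; apply: eq_big_nat => j /andP[tj jT].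
have -> : \prod_(t <= l < j.+1) (Ahat D T l)^T =
    (Ahat D T t)^T *m \prod_(t.+1 <= l < j.+1) (Ahat D T l)^T.
  by rewrite big_ltn // ltnS ltnW.
by rewrite !mulmxA.
Qed.

(** The e_t of the overview. Its products start at t + 1 because it is a part of the co-state at t +
    1. *)
Definition costate_tail (w : nat -> 'cV[R]_nw) (t : nat) : 'cV[R]_nx :=
  \sum_((t + p).+1 <= j < T)
    (\prod_(t.+1 <= l < j.+1) (Ahat D T l)^T) *m S j.+1 *m Bw j *m w j.

Lemma info_w_at x0 w u t j :
  info_w (info_at D T p x0 w u t) j =
  if (j < minn (t + p).+1 T)%N then w j else 0.
Proof.
rewrite /info_w /info_at /=; case: ifPn => [jm|].
  by rewrite (nth_map (Ordinal jm)) ?size_enum_ord // nth_enum_ord.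
by rewrite -leqNgt => mj; rewrite nth_default // size_map size_enum_ord.
Qed.

Lemma info_x_at x0 w u t : info_x (info_at D T p x0 w u t) = state D x0 w u t.
Proof. by rewrite /info_x /info_at /= tnth_mktuple. Qed.

(** When t + p >= T the sum in [preview_v] runs past the horizon; [info_w] then reads its default
    value 0, so the sum effectively stops at min(t + p + 1, T), and the tail is empty if that
    minimum is T. *)
Lemma costate_preview x0 w u t : (t < T)%N ->
  costate w t.+1 =
  preview_v D (info_at D T p x0 w u t) + costate_tail w t.
Proof.
move=> tT; rewrite /preview_v.
set F := fun j => (\prod_(t.+1 <= l < j.+1) (Ahat D T l)^T)
  *m S j.+1 *m Bw j *m w j.
have tp : (t < (t + p).+1)%N by rewrite ltnS leq_addr.
have -> : \sum_(t.+1 <= j < (t + p).+1)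
     (\prod_(t.+1 <= l < j.+1) (Ahat D T l)^T) *m S j.+1 *m Bw j
       *m info_w (info_at D T p x0 w u t) j =
   \sum_(t.+1 <= j < minn (t + p).+1 T) F j.
  rewrite (big_cat_nat (n := minn (t + p).+1 T)) /= ?geq_minl //; last first.
    by rewrite leq_min tp.
  rewrite [X in _ + X]big1_seq ?addr0; last first.
    move=> j /andP[_]; rewrite mem_index_iota => /andP[mj _].
    by rewrite info_w_at ltnNge mj mulmx0.
  by apply: eq_big_nat => j /andP[_ jm]; rewrite info_w_at jm.
rewrite /costate_tail -/F /costate -/F.
have [pT|Tp] := leqP (t + p).+1 T.
  by rewrite -big_cat_nat //= ltnW.
by rewrite [X in _ + X]big_geq ?addr0 // ltnW.
Qed.

Definition deviation x0 w u t : 'cV[R]_nu :=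
  u t - lqr_action D (info_at D T p x0 w u t).

(** The V(w) of the overview. Without the forms in [costate_tail] this is the least cost when the
    whole path is known in advance; each such form is the price of not seeing beyond the preview at
    time t. *)
Definition offline_cost (x0 : 'cV[R]_nx) w : R :=
  quad (S 0) x0 + dot (costate w 0) x0 *+ 2 +
  \sum_(t < T) (step_const t (Bw t *m w t) (costate w t.+1)
    + quad (H t) (gain_v D T t *m costate_tail w t)).

Lemma cost_decomposition x0 w u :
  cost D T x0 w u = offline_cost x0 w
    + \sum_(t < T) quad (H t) (deviation x0 w u t)
    + (\sum_(t < T)
         dot (deviation x0 w u t) ((Bu t)^T *m costate_tail w t)) *+ 2.
Proof.
set x := state D x0 w u.
(* Telescoping invariant: running cost up to time n plus the value function at x_n, with the
   co-state as its linear part. *)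
have step n : (n <= T)%N ->
  \sum_(t < n) (quad (Q t) (x t) + quad (Rw t) (u t)) + quad (S n) (x n)
    + dot (costate w n) (x n) *+ 2 =
  quad (S 0) x0 + dot (costate w 0) x0 *+ 2 +
  \sum_(t < n) (step_const t (Bw t *m w t) (costate w t.+1)
    + quad (H t) (u t + gain_x D T t *m x t
        + gain_v D T t *m (S t.+1 *m (Bw t *m w t) + costate w t.+1))).
  elim: n => [|n IH] nT; first by rewrite !big_ord0 /= addr0 add0r.
  rewrite !big_ord_recr /= [RHS]addrA -IH ?(ltnW nT) //.
  have := @riccati_step n (x n) (u n) (Bw n *m w n) (costate w n.+1) nT
    (riccati_psd nT).
  rewrite -costateE // => /= e.
  rewrite !mulr2n in e *; lra.
have hT := step T (leqnn T).
(* The square is centred at the input that knows the whole path, u* - K_v e_t. Since H_t K_v =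
   B_u^T, expanding around u* creates the cross term with B_u^T e_t. *)
have dev t : (t < T)%N ->
  quad (H t) (u t + gain_x D T t *m x t
     + gain_v D T t *m (S t.+1 *m (Bw t *m w t) + costate w t.+1)) =
  quad (H t) (deviation x0 w u t)
    + dot (deviation x0 w u t) ((Bu t)^T *m costate_tail w t) *+ 2
    + quad (H t) (gain_v D T t *m costate_tail w t).
  move=> tT; have [Hsym _] := Hmx_pd tT; have Hu := sym_pd_unit (Hmx_pd tT).
  rewrite (costate_preview x0 w u tT).
  set v := preview_v _ _; set e := costate_tail w t.
  have -> : u t + gain_x D T t *m x t
     + gain_v D T t *m (S t.+1 *m (Bw t *m w t) + (v + e))
     = deviation x0 w u t + gain_v D T t *m e.
    rewrite /deviation /lqr_action info_x_at info_w_at -/v -/x.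
    have -> : (t < minn (t + p).+1 T)%N by rewrite leq_min tT ltnS leq_addr.
    rewrite addrA mulmxDr addrA; congr (_ + _).
    rewrite mulmxDr !opprD !opprK !addrA; congr (_ + _ + _).
    by rewrite /gain_w /gain_v !mulmxA.
  by rewrite quadD // {2}/gain_v !mulmxA mulmxV // mul1mx.
rewrite /cost -/x addrC.
have costateT : costate w T = 0 by rewrite /costate big_geq.
move: hT; rewrite costateT [dot 0 _]dotC dot0r mul0rn addr0 riccatiT => ->.
rewrite /offline_cost -!addrA; congr (_ + _); congr (_ + _).
rewrite -sumrMnl -!big_split /=; congr (_ + _); apply: eq_bigr => t _.
rewrite dev //; ring.
Qed.

End lq_algebra.

(** * Measurability *)

Section matrix_measurability.
Context d (S : measurableType d) (R : realType).
Implicit Types m n : nat.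

Lemma measurable_matrixP m n (f : S -> 'M[R]_(m, n)) :
  measurable_fun setT f <->
  forall i j, measurable_fun setT (fun s => f s i j).
Proof.
split=> [mf i j|mf].
  have me : measurable_fun setT (fun M : 'M[R]_(m, n) => M i j).
    move=> _ B mB; rewrite setTI; apply: sub_sigma_algebra.
    by exists i, j, B.
  exact: measurableT_comp me mf.
apply: (measurability [set A | exists i j, exists2 B, measurable B &
   A = [set M : 'M[R]_(m, n) | B (M i j)]]) => //.
by move=> _ [_ [i [j [B mB ->]]] <-]; exact: mf.
Qed.

Lemma measurable_mulmx m n q (A : 'M[R]_(m, n)) (f : S -> 'M[R]_(n, q)) :
  measurable_fun setT f -> measurable_fun setT (fun s => A *m f s).
Proof.
move=> /measurable_matrixP mf; apply/measurable_matrixP => i j.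
under eq_fun do rewrite mxE.
by apply: measurable_sum => k; apply: measurable_funM.
Qed.

Lemma measurable_addmx m n (f g : S -> 'M[R]_(m, n)) :
  measurable_fun setT f -> measurable_fun setT g ->
  measurable_fun setT (fun s => f s + g s).
Proof.
move=> /measurable_matrixP mf /measurable_matrixP mg.
apply/measurable_matrixP => i j; under eq_fun do rewrite mxE.
exact: measurable_funD.
Qed.

Lemma measurable_oppmx m n (f : S -> 'M[R]_(m, n)) :
  measurable_fun setT f -> measurable_fun setT (fun s => - f s).
Proof.
move=> /measurable_matrixP mf; apply/measurable_matrixP => i j.
under eq_fun do rewrite mxE.
exact: measurableT_comp.
Qed.

Lemma measurable_summx (I : Type) (r : seq I) (Q : pred I) m n
    (f : I -> S -> 'M[R]_(m, n)) :
  (forall i, measurable_fun setT (f i)) ->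
  measurable_fun setT (fun s => \sum_(i <- r | Q i) f i s).
Proof.
move=> mf; apply/measurable_matrixP => i j; under eq_fun do rewrite summxE.
under eq_fun do rewrite big_mkcond; apply: measurable_sum => k.
by case: (Q k) => //; have /measurable_matrixP := mf k; exact.
Qed.

Lemma measurable_dot n (f g : S -> 'cV[R]_n) :
  measurable_fun setT f -> measurable_fun setT g ->
  measurable_fun setT (fun s => dot (f s) (g s)).
Proof.
move=> /measurable_matrixP mf /measurable_matrixP mg.
under eq_fun do rewrite dotE.
by apply: measurable_sum => k; apply: measurable_funM.
Qed.

Lemma measurable_quad n (M : 'M[R]_n) (f : S -> 'cV[R]_n) :
  measurable_fun setT f -> measurable_fun setT (fun s => quad M (f s)).
Proof.
move=> mf; under eq_fun do rewrite quadE.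
by apply: measurable_dot => //; exact: measurable_mulmx.
Qed.

Lemma measurable_mx_eq n (f g : S -> 'cV[R]_n) :
  measurable_fun setT f -> measurable_fun setT g ->
  measurable_fun setT (fun s => f s == g s).
Proof.
move=> mf mg.
have -> : (fun s => f s == g s) = (fun s => dot (f s - g s) (f s - g s) == 0).
  apply/funext => s; rewrite -subr_eq0 dotE.
  apply/eqP/eqP => [->|/eqP].
    by apply: big1 => k _; rewrite mxE mul0r.
  rewrite psumr_eq0 => [/allP h|k _]; last by rewrite -expr2 sqr_ge0.
  apply/matrixP => i j; rewrite ord1 [RHS]mxE; have := h i.
  by rewrite mem_index_enum -expr2 sqrf_eq0 => /(_ isT)/eqP.
apply: measurable_fun_eqr; last exact: measurable_cst.
by apply: measurable_dot; apply: measurable_addmx => //;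
  apply: measurable_oppmx.
Qed.

End matrix_measurability.

Definition path_measurable d (S : measurableType d) (R : realType) n
    (u : S -> nat -> 'cV[R]_n) :=
  forall t, measurable_fun setT (fun s => u s t).

Lemma path_measurable_comp d d' (S : measurableType d) (S' : measurableType d')
    (R : realType) n (u : S -> nat -> 'cV[R]_n) (f : S' -> S) :
  path_measurable u -> measurable_fun setT f ->
  path_measurable (fun s => u (f s)).
Proof. by move=> mu mf t; exact: measurableT_comp (mu t) mf. Qed.

Lemma path_measurable_nth (R : realType) n q :
  path_measurable (fun (x : q.-tuple 'cV[R]_n) i => nth 0 x i).
Proof.
move=> i; have [iq|qi] := ltnP i q; last first.
  under eq_fun do rewrite nth_default ?size_tuple //.
  exact: measurable_cst.
under eq_fun do rewrite -(tnth_nth 0 _ (Ordinal iq)).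
exact: (measurable_tnth (Ordinal iq)).
Qed.

Section lq_measurability.
Context d (S : measurableType d).
Variables (R : realType) (nx nu nw : nat) (D : lq_data R nx nu nw) (T p : nat).
Variables (x0 : 'cV[R]_nx) (w : S -> nat -> 'cV[R]_nw)
  (u : S -> nat -> 'cV[R]_nu).
Hypotheses (mw : path_measurable w) (mu : path_measurable u).

Lemma measurable_state t :
  measurable_fun setT (fun s => state D x0 (w s) (u s) t).
Proof.
elim: t => [|t IH] /=; first exact: measurable_cst.
apply: measurable_addmx; last exact: measurable_mulmx.
by apply: measurable_addmx; exact: measurable_mulmx.
Qed.

Lemma measurable_cost : measurable_fun setT (fun s => cost D T x0 (w s) (u s)).
Proof.
apply: measurable_funD; first exact/measurable_quad/measurable_state.
apply: measurable_sum => t; apply: measurable_funD; apply: measurable_quad.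
  exact: measurable_state.
exact: mu.
Qed.

Lemma measurable_info_at t :
  measurable_fun setT (fun s => info_at D T p x0 (w s) (u s) t).
Proof.
apply: measurable_fun_pair; apply/measurable_fun_tnthP => i.
  rewrite /comp; under eq_fun do rewrite tnth_mktuple.
  exact: measurable_state.
by rewrite /comp; under eq_fun do rewrite tnth_mktuple; exact: mw.
Qed.

End lq_measurability.

Section lqr_action_measurability.
Variables (R : realType) (nx nu nw : nat) (D : lq_data R nx nu nw) (T p : nat).

Lemma measurable_info_w t j :
  measurable_fun setT (fun i : info R nx nw T p t => info_w i j).
Proof.
exact: measurableT_comp (@path_measurable_nth _ _ _ j) measurable_snd.
Qed.

Lemma measurable_lqr_action t :
  measurable_fun setT (fun i : info R nx nw T p t => lqr_action D i).
Proof.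
apply: measurable_addmx; last first.
  apply: measurable_oppmx; apply: measurable_mulmx.
  apply: measurable_summx => j; apply: measurable_mulmx.
  exact: measurable_info_w.
apply: measurable_addmx; apply: measurable_oppmx; apply: measurable_mulmx.
  exact: measurableT_comp (measurable_tnth ord_max) measurable_fst.
exact: measurable_info_w.
Qed.

Lemma measurable_deviation d (S : measurableType d) (x0 : 'cV[R]_nx)
    (w : S -> nat -> 'cV[R]_nw) (u : S -> nat -> 'cV[R]_nu) t :
  path_measurable w -> path_measurable u ->
  measurable_fun setT (fun s => deviation D T p x0 (w s) (u s) t).
Proof.
move=> mw mu; apply: measurable_addmx; first exact: mu.
apply: measurable_oppmx; apply: measurableT_comp.
  exact: measurable_lqr_action.
exact: measurable_info_at.
Qed.

End lqr_action_measurability.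

(** * Policies as kernels, and iterated draws *)

Section kernel_precomposition.
Context d1 d2 d3 (X : measurableType d1) (Y : measurableType d2)
  (Z : measurableType d3) (R : realType).
Variables (k : R.-pker Y ~> Z) (f : X -> Y).

(** Makes the policy K_t, a kernel on [info t], a kernel on any space that carries the disturbances
    and the earlier actions. The proof [mf] is an argument so that the kernel structure can be
    attached to the term. *)
Definition kernel_pre (mf : measurable_fun setT f) (x : X) :
  {measure set Z -> \bar R} := k (f x).

Hypothesis mf : measurable_fun setT f.

Let measurable_kernel_pre U : measurable U ->
  measurable_fun setT (kernel_pre mf ^~ U).
Proof.
by move=> mU; exact: measurableT_comp (measurable_kernel k U mU) mf.
Qed.

HB.instance Definition _ := isKernel.Build _ _ _ _ _ (kernel_pre mf)
  measurable_kernel_pre.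

Let kernel_pre_prob x : kernel_pre mf x setT = 1%E.
Proof. exact: prob_kernel. Qed.

HB.instance Definition _ := Kernel_isProbability.Build _ _ _ _ _
  (kernel_pre mf) kernel_pre_prob.

End kernel_precomposition.

Section draws.
Variables (R : realType) (nx nu nw : nat) (D : lq_data R nx nu nw) (T p : nat).
Variables (K : policy R nx nu nw T p) (x0 : 'cV[R]_nx).

Local Notation draw := (draw_actions D K x0).

(* Quantifying over all test spaces avoids a sigma-algebra on the input
   sequences, which are functions on [nat]. *)
Definition jointly_measurable d (S : measurableType d)
    (F : S -> (nat -> 'cV[R]_nu) -> \bar R) :=
  forall d' (S' : measurableType d') (f : S' -> S) (u : S' -> nat -> 'cV[R]_nu),
    measurable_fun setT f -> path_measurable u ->
    measurable_fun setT (fun s => F (f s) (u s)).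

Lemma path_measurable_update d d' (S : measurableType d) (X : measurableType d')
    (f : X -> S) (g : X -> 'cV[R]_nu) (u : S -> nat -> 'cV[R]_nu) t :
  measurable_fun setT f -> measurable_fun setT g -> path_measurable u ->
  path_measurable (fun x s => if s == t then g x else u (f x) s).
Proof.
move=> mf mg mu s; case: (s == t) => //; exact: measurableT_comp (mu s) mf.
Qed.

Lemma draw_ge0 w F k t u : (forall u, 0 <= F u)%E -> (0 <= draw w F k t u)%E.
Proof.
move=> F0; elim: k t u => [|k IH] t u //=.
by apply: integral_ge0 => a _; exact: IH.
Qed.

(** Each draw integrates over one more action. The induction adds this action to the parameter
    space, which is why [S] varies, and uses that a kernel integral is measurable in its
    parameter. *)
Lemma measurable_draw d (S : measurableType d) (w : S -> nat -> 'cV[R]_nw)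
    (F : S -> (nat -> 'cV[R]_nu) -> \bar R) (u : S -> nat -> 'cV[R]_nu) k t :
  (forall s u, 0 <= F s u)%E -> jointly_measurable F ->
  path_measurable w -> path_measurable u ->
  measurable_fun setT (fun s => draw (w s) (F s) k t (u s)).
Proof.
elim: k t d S w F u => [|k IH] t d S w F u F0 mF mw mu /=.
  by apply: (mF _ _ id u) => //; exact: measurable_id.
have mi : measurable_fun setT (fun s => info_at D T p x0 (w s) (u s) t).
  exact: measurable_info_at.
pose G (z : S * 'cV[R]_nu) := draw (w z.1) (F z.1) k t.+1
   (fun s => if s == t then z.2 else u z.1 s).
have mG : measurable_fun setT G.
  apply: (IH t.+1 _ (S * 'cV[R]_nu)%type (fun z => w z.1) (fun z => F z.1)
    (fun z s => if s == t then z.2 else u z.1 s)).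
  - by move=> z v; exact: F0.
  - move=> d' S' f v mf mv; apply: (mF _ _ (fst \o f)) => //.
    exact: measurableT_comp measurable_fst mf.
  - by move=> s; exact: measurableT_comp (mw s) measurable_fst.
  - exact: path_measurable_update.
have := measurable_fun_integral_finite_kernel G (kernel_pre (K t) mi) _ mG.
by apply => z; exact: draw_ge0.
Qed.

End draws.

(** * The joint law of the disturbances and the actions *)

Section joint_law.
Context d1 d2 (S : measurableType d1) (Y : measurableType d2) (R : realType).
Variables (mu : probability S R) (k : R.-pker S ~> Y).

Definition unit_kernel := kprobability
  (@measurable_cst _ _ unit _ setT (mu : pprobability S R)).

(** Sends s to the law of (s, y) with y drawn from k s. The factor [unit] lets [mu] be viewed as a
    kernel, so that [joint_law] is a composition of kernels and inherits sigma-additivity and an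
    integral formula. *)
Definition pair_kernel : R.-sfker (unit * S)%type ~> (S * Y)%type :=
  mkcomp (kernel_pre k (@measurable_snd _ _ unit S))
    (kdirac (measurable_fun_pair
       (measurableT_comp (@measurable_snd _ _ unit S)
          (@measurable_fst _ _ (unit * S)%type Y))
       (@measurable_snd _ _ (unit * S)%type Y))).

Definition joint_law : set (S * Y) -> \bar R :=
  mkcomp unit_kernel pair_kernel tt.

HB.instance Definition _ := Measure.on joint_law.

Lemma integral_joint_law f :
  (forall z, 0 <= f z)%E -> measurable_fun setT f ->
  (\int[joint_law]_z f z = \int[mu]_s \int[k s]_y f (s, y))%E.
Proof.
move=> f0 mf; rewrite /joint_law integral_kcomp //.
apply: eq_integral => s _; rewrite integral_kcomp //.
apply: eq_integral => y _; rewrite integral_dirac //.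
by rewrite diracT mul1e.
Qed.

Let joint_law_setT : joint_law setT = 1%E.
Proof.
have := @integral_joint_law (cst 1%E) (fun=> lee01)
  (@measurable_cst _ _ _ _ _ _).
rewrite integral_cst // mul1e => ->.
under eq_integral do rewrite integral_cst // mul1e prob_kernel.
by rewrite integral_cst // mul1e; exact: (@probability_setT _ _ _ mu).
Qed.

HB.instance Definition _ :=
  Measure_isProbability.Build _ _ _ joint_law joint_law_setT.

End joint_law.

Section closed_loop_law.
Variables (R : realType) (nx nu nw : nat) (D : lq_data R nx nu nw) (T p : nat).
Variables (K : policy R nx nu nw T p) (x0 : 'cV[R]_nx).

(** Each draw replaces the base space by its product with the action space, under [joint_law]. The
    resulting space depends on [k], hence the existential over measurable types. *)
Lemma draw_law_exists k t d (S : measurableType d) (mu : probability S R)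
    (w : S -> nat -> 'cV[R]_nw) (u : S -> nat -> 'cV[R]_nu) :
  path_measurable w -> path_measurable u ->
  exists d' (Z : measurableType d') (nu' : probability Z R) (f : Z -> S)
    (v : Z -> nat -> 'cV[R]_nu),
  [/\ measurable_fun setT f, path_measurable v &
   forall F, (forall s u, 0 <= F s u)%E -> jointly_measurable F ->
   (\int[mu]_s draw_actions D K x0 (w s) (F s) k t (u s) =
    \int[nu']_z F (f z) (v z))%E].
Proof.
elim: k t d S mu w u => [|k IH] t d S mu w u mw mu_.
  by exists d, S, mu, id, u; split=> //; exact: measurable_id.
have mi : measurable_fun setT (fun s => info_at D T p x0 (w s) (u s) t).
  exact: measurable_info_at.
pose mu' : probability (S * 'cV[R]_nu)%type R :=
  joint_law mu (kernel_pre (K t) mi).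
pose w' (z : S * 'cV[R]_nu) := w z.1.
pose u' (z : S * 'cV[R]_nu) s := if s == t then z.2 else u z.1 s.
have mw' : path_measurable w'.
  by move=> s; exact: measurableT_comp (mw s) measurable_fst.
have mu'_ : path_measurable u' by exact: path_measurable_update.
have [d' [Z [nu' [f [v [mf mv vE]]]]]] := IH t.+1 _ _ mu' w' u' mw' mu'_.
exists d', Z, nu', (fst \o f), v; split=> //.
  exact: measurableT_comp measurable_fst mf.
move=> F F0 mF.
have mF' : jointly_measurable (fun z : S * 'cV[R]_nu => F z.1).
  move=> d'' S' f' v' mf' mv'; apply: (mF _ _ (fst \o f')) => //.
  exact: measurableT_comp measurable_fst mf'.
rewrite -(vE (fun z => F z.1)) // integral_joint_law //=.
  by move=> z; exact: draw_ge0.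
by apply: measurable_draw => // z; exact: F0.
Qed.

End closed_loop_law.

(** * What the draws depend on, and draws from a Dirac policy *)

Section draw_combinatorics.
Variables (R : realType) (nx nu nw : nat) (D : lq_data R nx nu nw) (T p : nat).
Variables (K : policy R nx nu nw T p) (x0 : 'cV[R]_nx).

Local Notation draw := (draw_actions D K x0).
Local Notation info_at := (info_at D T p x0).

Lemma state_congr w w' u u' t :
  (forall j, (j < t)%N -> w j = w' j) -> (forall s, (s < t)%N -> u s = u' s) ->
  state D x0 w u t = state D x0 w' u' t.
Proof.
elim: t => [|t IH] //= ww uu.
rewrite IH => [|j jt|s st]; last 2 first.
- exact/ww/ltnW.
- exact/uu/ltnW.
by rewrite ww ?uu.
Qed.

(** The states in i_t involve only w_j with j < t, and t <= T places these inside the visible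
    window. Actions enter for s < t strictly, since u_t is drawn after i_t. *)
Lemma info_at_congr w w' u u' t : (t <= T)%N ->
  (forall j, (j < minn (t + p).+1 T)%N -> w j = w' j) ->
  (forall s, (s < t)%N -> u s = u' s) ->
  info_at w u t = info_at w' u' t.
Proof.
move=> tT ww uu; congr pair; apply: eq_from_tnth => i; rewrite !tnth_mktuple.
  have it : (i <= t)%N by rewrite -ltnS.
  apply: state_congr => j ji; last exact/uu/(leq_trans ji it).
  apply: ww; apply: (leq_trans ji); apply: (leq_trans it).
  by rewrite leq_min tT andbT leqW // leq_addr.
exact: ww.
Qed.

Lemma draw_congr w w' F F' k t u :
  (forall s v, (t <= s < t + k)%N -> info_at w v s = info_at w' v s) ->
  F =1 F' -> draw w F k t u = draw w' F' k t u.
Proof.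
move=> ww FF; elim: k t u ww => [|k IH] t u ww /=; first exact: FF.
rewrite ww ?leqnn ?addnS ?ltnS ?leq_addr //.
apply: eq_integral => a _; apply: IH => s v /andP[ts sk].
by rewrite ww // (ltnW ts) addnS.
Qed.

Lemma draw_cat w F k1 k2 t u :
  draw w F (k1 + k2) t u = draw w (draw w F k2 (t + k1)) k1 t u.
Proof.
elim: k1 t u => [|k1 IH] t u /=; first by rewrite addn0.
by apply: eq_integral => a _; rewrite IH addSnnS.
Qed.

(** Draws that cannot affect [F] integrate a constant against a probability. *)
Lemma draw_future w F k t u :
  (forall v v', (forall s, (s < t)%N -> v s = v' s) -> F v = F v') ->
  draw w F k t u = F u.
Proof.
elim: k t u => [|k IH] t u Fcst //=.
under eq_integral => a _.
  rewrite IH; last by move=> v v' vv; apply: Fcst => s st; apply/vv/ltnW.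
  rewrite (Fcst _ u); last by move=> s st; rewrite ltn_eqF.
  over.
by rewrite integral_cst // prob_kernel mule1.
Qed.

(** A Dirac policy puts all mass on one action sequence, its closed loop along [w]. The sequence is
    produced before [F], so that it also serves purely pathwise statements such as
    [offline_cost_ge0]. *)
Lemma draw_dirac w k t u : (t + k <= T)%N ->
  (forall s (i : info R nx nw T p s), (s < T)%N ->
    K s i = \d_(lqr_action D i) :> (set _ -> \bar R)) ->
  exists v, [/\ forall s, (s < t)%N -> v s = u s,
    forall s, (t <= s < t + k)%N -> deviation D T p x0 w v s = 0 &
    forall F : (nat -> 'cV[R]_nu) -> \bar R, (forall v, 0 <= F v)%E ->
      (forall d (S : measurableType d) (v : S -> nat -> 'cV[R]_nu),
        path_measurable v -> measurable_fun setT (fun s => F (v s))) ->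
      draw w F k t u = F v].
Proof.
move=> + hK; elim: k t u => [|k IH] t u tkT.
  exists u; split=> // s; rewrite addn0 => /andP[/leq_ltn_trans h /h].
  by rewrite ltnn.
have tT : (t < T)%N by apply: leq_trans tkT; rewrite addnS ltnS leq_addr.
set a := lqr_action D (info_at w u t).
have [|v [vu vdev vE]] := IH t.+1 (fun s => if s == t then a else u s).
  by rewrite addSnnS.
have vu' s : (s < t)%N -> v s = u s.
  by move=> st; rewrite vu ?leqW // ltn_eqF.
exists v; split=> // [s /andP[]|F F0 mF].
  rewrite leq_eqVlt => /orP[/eqP <- _|ts sk]; last first.
    by rewrite vdev // ts addSnnS.
  rewrite /deviation vu // eqxx (info_at_congr (u' := u) (w' := w)) ?subrr //.
  exact: ltnW.
rewrite -vE //=.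
set G := fun b => draw w F k t.+1 (fun s => if s == t then b else u s).
have mG : measurable_fun setT G.
  apply: (@measurable_draw _ _ _ _ _ _ _ K x0 _ _ (fun=> w) (fun=> F)
    (fun b s => if s == t then b else u s)) => //.
  - by move=> d S f v' mf mv; exact: mF.
  - move=> s; case: (s == t); [exact: measurable_id|exact: measurable_cst].
rewrite -/(G _) -/(G a).
(* [hK] equates set functions, so the integral is moved to the Dirac measure by agreement on
   measurable sets. *)
rewrite (eq_measure_integral (dirac a)).
  by rewrite integral_dirac // diracT mul1e.
by move=> A mA _; rewrite hK.
Qed.

End draw_combinatorics.

(** * Independence of the disturbances beyond the preview *)

Section tuple_sigma_algebra.
Context d (T : measurableType d) (n : nat).

(** A pi-system for the product sigma-algebra: sets constraining a single coordinate generate it but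
    are not closed under intersection. *)
Definition tuple_boxes : set (set (n.-tuple T)) :=
  [set A | exists2 B : 'I_n -> set T, (forall i, measurable (B i)) &
     A = [set x | forall i, B i (tnth x i)]].

Lemma tuple_boxes_setI_closed : setI_closed tuple_boxes.
Proof.
move=> _ _ [B mB ->] [C mC ->]; exists (fun i => B i `&` C i).
  by move=> i; exact: measurableI.
apply/seteqP; split=> [x [hB hC] i|x h]; first by split.
by split=> i; have [] := h i.
Qed.

Lemma tuple_boxesT : tuple_boxes setT.
Proof. by exists (fun=> setT) => //; apply/seteqP; split. Qed.

Lemma measurable_tuple_boxes : @measurable _ (n.-tuple T) = <<s tuple_boxes >>.
Proof.
apply/seteqP; split; last first.
  apply: smallest_sub; first exact: sigma_algebra_measurable.
  move=> _ [B mB ->].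
  have -> : [set x : n.-tuple T | forall i, B i (tnth x i)] =
            \bigcap_(i in setT) ((@tnth _ T)^~ i @^-1` B i).
    by apply/seteqP; split=> [x h i _|x h i]; [exact: h|exact: h i I].
  apply: fin_bigcap_measurable => // i _; rewrite -[X in measurable X]setTI.
  exact: measurable_tnth.
apply: smallest_sub; first exact: smallest_sigma_algebra.
move=> A; rewrite -bigcup_seq => -[i _ [B mB <-]].
apply: sub_sigma_algebra; exists (fun j => if j == i then B else setT).
  by move=> j; case: eqP.
apply/seteqP; split=> [x [_ Bx] j|x h]; first by case: eqP => // ->.
by split=> //; have := h i; rewrite eqxx.
Qed.

End tuple_sigma_algebra.

Section noise_independence.
Context d (Omega : measurableType d) (R : realType) (P : probability Omega R).
Variables (n T : nat) (w : nat -> {RV P >-> 'cV[R]_n}).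
Hypothesis indep : mutually_independent T w.

Definition past (q : nat) (omega : Omega) : q.-tuple 'cV[R]_n :=
  [tuple w i omega | i < q].

Lemma measurable_noise j : measurable_fun setT (w j).
Proof. exact: measurable_funP. Qed.

Lemma measurable_past q : measurable_fun setT (past q).
Proof.
apply/measurable_fun_tnthP => i; rewrite /comp.
by under eq_fun do rewrite tnth_mktuple; exact: measurable_noise.
Qed.

Let mpre j B : measurable B -> measurable (w j @^-1` B).
Proof.
by move=> mB; rewrite -[X in measurable X]setTI; exact: measurable_noise.
Qed.

(** Independence is assumed for boxes. For fixed [B] both sides are finite measures in [A], so
    agreement on the pi-system of boxes suffices. *)
Lemma past_independent q j (A : set (q.-tuple 'cV[R]_n)) (B : set 'cV[R]_n) :
  (q <= j < T)%N -> measurable A -> measurable B ->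
  P (past q @^-1` A `&` w j @^-1` B) = (P (w j @^-1` B) * P (past q @^-1` A))%E.
Proof.
move=> /andP[qj jT] mA mB.
have qT : (q <= T)%N by exact: leq_trans (ltnW jT).
have mD := mpre j mB.
have PDfin : P (w j @^-1` B) \is a fin_num by exact: fin_num_measure.
have PD0 : 0 <= fine (P (w j @^-1` B)) by exact: fine_ge0.
have mpast : measurable_fun setT (past q) := @measurable_past q.
pose X : {RV P >-> q.-tuple 'cV[R]_n} := mfun_Sub (mem_set mpast).
pose M1' : {measure set _ -> \bar R} := pushforward (mrestr P mD) X.
pose M1 := M1' mpast.
pose M2 : {measure set _ -> \bar R} := mscale (NngNum PD0) (distribution P X).
have M1E C : M1 C = P (past q @^-1` C `&` w j @^-1` B) by [].
have M2E C : M2 C = (P (w j @^-1` B) * P (past q @^-1` C))%E.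
  by rewrite /M2 /= /mscale /= fineK.
suff : M1 A = M2 A.
  by rewrite M1E M2E.
apply: (measure_unique (@tuple_boxes _ _ q) (fun=> setT)) => //.
- exact: measurable_tuple_boxes.
- exact: tuple_boxes_setI_closed.
- by move=> _; exact: tuple_boxesT.
- by rewrite bigcup_const.
- move=> _ [C mC ->].
  (* Extends a box to all times: [C] below q, [E] at j, no constraint elsewhere, as
     [mutually_independent] expects. *)
  pose F (E : set 'cV[R]_n) i : set 'cV[R]_n :=
    if insub i is Some k then C k else if i == j then E else setT.
  have mF E i : measurable E -> measurable (F E i).
    by move=> mE; rewrite /F; case: insubP => [k _ _|_]; [exact: mC|case: eqP].
  have FE E : past q @^-1` [set x | forall i, C i (tnth x i)] `&` w j @^-1` E =
              \bigcap_(i in `I_T) (w i @^-1` F E i).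
    apply/seteqP; split=> [omega [/= hC hE] i /= iT|omega h].
      rewrite /F; case: insubP => [k _ <-|_]; last by case: eqP => // ->.
      by have := hC k; rewrite tnth_mktuple.
    split=> /= [i|].
      rewrite tnth_mktuple; have := h i (leq_trans (ltn_ord i) qT).
      by rewrite /= /F valK.
    have := h j jT; rewrite /= /F; case: insubP => [k + _|_].
      by rewrite ltnNge qj.
    by rewrite eqxx.
  have PF E : measurable E ->
    P (past q @^-1` [set x | forall i, C i (tnth x i)] `&` w j @^-1` E) =
    (P (w j @^-1` E) *
      \prod_(i < T | i != Ordinal jT) P (w i @^-1` F setT i))%E.
    move=> mE; rewrite FE (indep (fun i => mF E i mE)) (bigD1 (Ordinal jT)) //=.
    congr (_ * _)%E.
      rewrite /F; case: insubP => [k + _|_]; first by rewrite ltnNge qj.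
      by rewrite eqxx.
    apply: eq_bigr => i ij; rewrite /F; case: insubP => // _.
    by move: ij; rewrite -val_eqE /= => /negbTE ->.
  rewrite M1E M2E PF //; congr (_ * _)%E.
  (* Taking E = setT identifies the product over i != j with the probability of the box. *)
  have := PF setT measurableT.
  by rewrite preimage_setT setIT probability_setT mul1e.
- move=> _; apply: le_lt_trans (ltry 1).
  rewrite M1E preimage_setT setTI.
  exact: probability_le1.
Qed.

(** The law of the pair agrees with the product of the laws on rectangles, hence everywhere, and
    Tonelli factors the integral. *)
Lemma ge0_integral_past_noise q j (phi : q.-tuple 'cV[R]_n -> \bar R)
    (h : 'cV[R]_n -> \bar R) :
  (q <= j < T)%N ->
  measurable_fun setT phi -> (forall x, 0 <= phi x)%E ->
  measurable_fun setT h -> (forall x, 0 <= h x)%E ->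
  (\int[P]_omega (phi (past q omega) * h (w j omega)) =
   (\int[P]_omega phi (past q omega)) * \int[P]_omega h (w j omega))%E.
Proof.
move=> qjT mphi phi0 mh h0.
have mpast : measurable_fun setT (past q) := @measurable_past q.
pose X : {RV P >-> q.-tuple 'cV[R]_n} := mfun_Sub (mem_set mpast).
pose m1 := distribution P X; pose m2 := distribution P (w j).
have mXY : measurable_fun setT (fun omega => (past q omega, w j omega)).
  by apply: measurable_fun_pair => //; exact: measurable_noise.
pose XY : {RV P >-> (q.-tuple 'cV[R]_n * 'cV[R]_n)%type} :=
  mfun_Sub (mem_set mXY).
have XYE A : measurable A -> (m1 \x m2)%E A = distribution P XY A.
  apply: product_measure_unique => B C mB mC.
  rewrite /m1 /m2 /distribution /pushforward /= muleC -past_independent //.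
pose f (z : q.-tuple 'cV[R]_n * 'cV[R]_n) := (phi z.1 * h z.2)%E.
have mf : measurable_fun setT f.
  by apply: emeasurable_funM; [exact: measurableT_comp mphi measurable_fst|
    exact: measurableT_comp mh measurable_snd].
have f0 z : (0 <= f z)%E by exact: mule_ge0.
transitivity (\int[distribution P XY]_z f z)%E.
  by rewrite ge0_integral_distribution.
transitivity (\int[(m1 \x m2)%E]_z f z)%E.
  by apply: eq_measure_integral => A mA _; exact/esym/XYE.
rewrite fubini_tonelli1 // /fubini_F /f /=.
under eq_integral do rewrite ge0_integralZl //.
rewrite ge0_integralZr //; last by exact: integral_ge0.
by rewrite /m1 /m2 !ge0_integral_distribution.
Qed.

End noise_independence.

(** * Product rule between actions and unseen disturbances *)

Section closed_loop.
Variables (R : realType) (nx nu nw : nat) (D : lq_data R nx nu nw) (T p : nat).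
Variables (K : policy R nx nu nw T p) (x0 : 'cV[R]_nx).
Context d (Omega : measurableType d) (P : probability Omega R).
Variable w : nat -> {RV P >-> 'cV[R]_nw}.
Hypothesis indep : mutually_independent T w.

Local Notation draw := (draw_actions D K x0).

Lemma jointly_measurable_fst d1 d2 (S : measurableType d1)
    (S' : measurableType d2) (f : S' -> S)
    (F : S -> (nat -> 'cV[R]_nu) -> \bar R) :
  measurable_fun setT f -> jointly_measurable F ->
  jointly_measurable (fun s => F (f s)).
Proof.
by move=> mf mF d' S'' g u mg mu; apply: (mF _ _ (f \o g)) => //;
  exact: measurableT_comp mf mg.
Qed.

Lemma draw_scale w' F k t u (c : R) : 0 <= c ->
  (forall v, 0 <= F v)%E ->
  jointly_measurable (fun _ : 'cV[R]_nu => F) ->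
  draw w' (fun v => c%:E * F v)%E k t u = (c%:E * draw w' F k t u)%E.
Proof.
move=> c0 F0 mF; elim: k t u => [|k IH] t u //=.
under eq_integral do rewrite IH.
rewrite ge0_integralZl //.
- apply: (@measurable_draw _ _ _ _ _ _ _ K x0 _ _ (fun=> w') (fun=> F)
    (fun b s => if s == t then b else u s)) => //.
  by move=> s; case: (s == t); [exact: measurable_id|exact: measurable_cst].
- by move=> a _; exact: draw_ge0.
Qed.

Context d' (Z : measurableType d') (law : probability Z R).
Variables (f : Z -> Omega) (v : Z -> nat -> 'cV[R]_nu).
Hypothesis mf : measurable_fun setT f.
Hypothesis lawE : forall F : Omega -> (nat -> 'cV[R]_nu) -> \bar R,
  (forall s u, 0 <= F s u)%E -> jointly_measurable F ->
  policy_expectation D w x0 K F = (\int[law]_z F (f z) (v z))%E.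

(** Dependence on u_t itself is allowed, as the deviation at time t contains it. *)
Definition causal t q (g : q.-tuple 'cV[R]_nw -> (nat -> 'cV[R]_nu) -> R) :=
  forall x u u', (forall s, (s <= t)%N -> u s = u' s) -> g x u = g x u'.

Definition rjointly_measurable dS (S : measurableType dS)
    (g : S -> (nat -> 'cV[R]_nu) -> R) :=
  jointly_measurable (fun s u => (g s u)%:E).

(* Given the disturbances, the actions up to time t only depend on
   [w_0, ..., w_(t+p)], so they are independent of [w_j] for j > t + p. *)
Lemma ge0_integral_law_noise t j
    (g : (t + p).+1.-tuple 'cV[R]_nw -> (nat -> 'cV[R]_nu) -> R)
    (h : 'cV[R]_nw -> R) :
  (t + p < j < T)%N -> causal t g -> rjointly_measurable g ->
  (forall x u, 0 <= g x u) -> measurable_fun setT h -> (forall y, 0 <= h y) ->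
  (\int[law]_z (g (past w _ (f z)) (v z) * h (w j (f z)))%:E =
   (\int[law]_z (g (past w _ (f z)) (v z))%:E) *
   \int[P]_omega (h (w j omega))%:E)%E.
Proof.
move=> /andP[tpj jT] gc mg g0 mh h0.
set q := (t + p).+1 in g gc mg g0 *.
(* Conditional expectation of [g] given the first q disturbances: the draws up to time t read no
   others, so the path may be replaced by a finite list padded with zeros. *)
pose phi (x : q.-tuple 'cV[R]_nw) :=
  draw (fun i => nth 0 x i) (fun u => (g x u)%:E) t.+1 0 (fun=> 0).
have phi0 x : (0 <= phi x)%E by apply: draw_ge0 => u; rewrite lee_fin.
have mphi : measurable_fun setT phi.
  apply: (@measurable_draw _ _ _ _ _ _ _ K x0 _ _
    (fun (x : q.-tuple 'cV[R]_nw) i => nth 0 x i) (fun x u => (g x u)%:E)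
    (fun _ _ => 0)) => //.
  exact: path_measurable_nth.
have tT : (t.+1 <= T)%N.
  apply: leq_trans jT; rewrite ltnS ltnW //.
  exact: leq_ltn_trans (leq_addr _ _) tpj.
(* Stated for arbitrary h' because the instance h' = 1 later identifies the integral of [phi] with
   that of [g] under [law]. *)
have key (h' : 'cV[R]_nw -> R) :
    measurable_fun setT h' -> (forall y, 0 <= h' y) ->
  (\int[law]_z (g (past w _ (f z)) (v z) * h' (w j (f z)))%:E =
   (\int[P]_omega phi (past w q omega)) * \int[P]_omega (h' (w j omega))%:E)%E.
  move=> mh' h'0.
  rewrite -(@lawE (fun omega u => (g (past w q omega) u * h' (w j omega))%:E));
    last 2 first.
  - by move=> s u; rewrite lee_fin mulr_ge0.
  - move=> d1 S1 f1 u1 mf1 mu1; under eq_fun do rewrite EFinM.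
    apply: emeasurable_funM.
      apply: (mg _ _ (past w q \o f1)) => //.
      by apply: measurableT_comp mf1; exact: measurable_past.
    apply/measurable_EFinP; apply: measurableT_comp => //.
    by apply: measurableT_comp mf1; exact: measurable_noise.
  have qjT : (q <= j < T)%N by rewrite /q tpj.
  rewrite -(ge0_integral_past_noise indep qjT (h := fun y => (h' y)%:E)) //;
    last exact/measurable_EFinP.
  apply: eq_integral => omega _.
  have split_draw w' F u : draw w' F T 0 u =
      draw w' (draw w' F (T - t.+1) (0 + t.+1)) t.+1 0 u.
    by rewrite -draw_cat subnKC.
  rewrite split_draw add0n.
  transitivity (draw (noise_path w omega) (fun u =>
    (h' (w j omega))%:E * (g (past w q omega) u)%:E)%E t.+1 0 (fun=> 0)).
    apply: draw_congr => // u.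
    rewrite draw_future ?EFinM 1?muleC // => u1 u2 u12.
    by rewrite (gc _ u1 u2).
  rewrite draw_scale //; last 2 first.
  - by move=> u; rewrite lee_fin.
  - exact: jointly_measurable_fst (measurable_cst _) mg.
  rewrite muleC; congr (_ * _)%E; apply: draw_congr => // s u st.
  apply: info_at_congr => //.
    by move: st; rewrite add0n ltnS => /leq_trans; apply; exact: ltnW.
  move=> i ip; have iq : (i < q)%N.
    move: ip; rewrite leq_min => /andP[/leq_trans + _]; apply.
    by rewrite /q ltnS leq_add2r; move: st; rewrite add0n ltnS.
  by rewrite -(tnth_nth 0 _ (Ordinal iq)) tnth_mktuple.
rewrite key //; congr (_ * _)%E.
have := key (cst 1) (@measurable_cst _ _ _ _ _ _) (fun=> ler01).
have -> : (\int[P]_omega (cst 1 (w j omega))%:E = 1)%E.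
  transitivity (\int[P]_omega (cst 1%E omega))%E; first by [].
  by rewrite integral_cst // mul1e; exact: (@probability_setT _ _ _ P).
by rewrite mule1 => <-; apply: eq_integral => z _; rewrite mulr1.
Qed.

(** The product rule is available for nonnegative factors, so [g] and the noise entry are both split
    into positive and negative parts. Mean zero says that the two parts of the noise have equal
    integrals, and the four products then cancel in pairs. *)
Lemma integral_law_noise_eq0 t j l
    (g : (t + p).+1.-tuple 'cV[R]_nw -> (nat -> 'cV[R]_nu) -> R) :
  (t + p < j < T)%N -> causal t g -> rjointly_measurable g ->
  law.-integrable setT (fun z => (g (past w _ (f z)) (v z))%:E) ->
  P.-integrable setT (fun omega => (w j omega l 0)%:E) ->
  (\int[P]_omega (w j omega l 0)%:E = 0)%E ->
  (\int[law]_z (g (past w _ (f z)) (v z) * w j (f z) l 0)%:E = 0)%E.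
Proof.
move=> tpjT gc mg ig iw w0.
pose pos (a : R) : R := Num.max a 0; pose neg (a : R) : R := Num.max (- a) 0.
have pos0 a : 0 <= pos a by rewrite le_max lexx orbT.
have neg0 a : 0 <= neg a by rewrite le_max lexx orbT.
have posneg a : a = pos a - neg a.
  by rewrite /pos /neg; case: (leP a 0) => ha; case: (leP (- a) 0) => hb; lra.
have pos_le a : pos a <= `|a| by rewrite ge_max ler_norm normr_ge0.
have neg_le a : neg a <= `|a| by rewrite ge_max -normrN ler_norm normr_ge0.
have mpos : measurable_fun setT pos by apply: measurable_maxr.
have mneg : measurable_fun setT neg.
  by apply: measurable_maxr => //; exact: oppr_measurable.
have mcoord : measurable_fun setT (fun y : 'cV[R]_nw => y l 0).
  by have /measurable_matrixP := @measurable_id _ 'cV[R]_nw setT; exact.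
have mgs (s : R -> R) : measurable_fun setT s ->
    rjointly_measurable (fun x u => s (g x u)).
  move=> ms d1 S1 f1 u1 mf1 mu1; apply/measurable_EFinP.
  by apply: measurableT_comp => //; apply/measurable_EFinP; exact: mg.
have gcs (s : R -> R) : causal t (fun x u => s (g x u)).
  by move=> x u u' uu'; rewrite (gc _ _ _ uu').
pose X z := g (past w _ (f z)) (v z).
pose Y omega : R := w j omega l 0.
have mX : measurable_fun setT X.
  by have /measurable_int/measurable_EFinP := ig.
have mY : measurable_fun setT Y.
  by have /measurable_int/measurable_EFinP := iw.
have mYf : measurable_fun setT (Y \o f) by exact: measurableT_comp.
have prodE (s r : R -> R) : measurable_fun setT s -> measurable_fun setT r ->
    (forall a, 0 <= s a) -> (forall a, 0 <= r a) ->
  (\int[law]_z (s (X z) * r (Y (f z)))%:E =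
   (\int[law]_z (s (X z))%:E) * \int[P]_omega (r (Y omega))%:E)%E.
  move=> ms mr s0 r0.
  apply: (@ge0_integral_law_noise t j (fun x u => s (g x u))
    (fun y => r (y l 0))).
  - exact: tpjT.
  - exact: gcs.
  - exact: mgs.
  - by move=> *; exact: s0.
  - exact: measurableT_comp.
  - by move=> *; exact: r0.
have fin_part dd (U : measurableType dd) (m : probability U R) (h : U -> R)
    (s : R -> R) : m.-integrable setT (EFin \o h) -> measurable_fun setT s ->
    (forall a, 0 <= s a) -> (forall a, s a <= `|a|) ->
    m.-integrable setT (fun z => (s (h z))%:E).
  move=> ih ms s0 sle; apply: (le_integrable measurableT _ _ ih) => //.
    apply/measurable_EFinP; apply: measurableT_comp => //.
    by have /measurable_int/measurable_EFinP := ih.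
  by move=> z _; rewrite /= lee_fin ger0_norm.
have iXp := fin_part _ _ law X pos ig mpos pos0 pos_le.
have iXn := fin_part _ _ law X neg ig mneg neg0 neg_le.
have iYp := fin_part _ _ P Y pos iw mpos pos0 pos_le.
have iYn := fin_part _ _ P Y neg iw mneg neg0 neg_le.
have Ypn : (\int[P]_omega (pos (Y omega))%:E =
            \int[P]_omega (neg (Y omega))%:E)%E.
  have : (\int[P]_omega ((pos (Y omega))%:E - (neg (Y omega))%:E) = 0)%E.
    by rewrite -w0; apply: eq_integral => omega _; rewrite -EFinB -posneg.
  rewrite integralB // => /eqP; rewrite sube_eq ?add0e => [/eqP//||].
    exact: integrable_fin_num.
  by rewrite fin_num_adde_defl // integrable_fin_num.
have prodI (s r : R -> R) : measurable_fun setT s -> measurable_fun setT r ->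
    (forall a, 0 <= s a) -> (forall a, 0 <= r a) ->
    law.-integrable setT (fun z => (s (X z))%:E) ->
    P.-integrable setT (fun omega => (r (Y omega))%:E) ->
    law.-integrable setT (fun z => (s (X z) * r (Y (f z)))%:E).
  move=> ms mr s0 r0 is_ ir; apply/integrableP; split.
    by apply/measurable_EFinP; apply: measurable_funM; exact: measurableT_comp.
  under eq_integral do rewrite gee0_abs ?lee_fin ?mulr_ge0 //.
  by rewrite prodE // ltey_eq fin_numM // integrable_fin_num.
(* X Y o f = F pos neg - F neg pos, and these two terms have the same integral. *)
pose F (s1 s2 : R -> R) z : \bar R :=
  ((pos (X z) * s1 (Y (f z)))%:E + (neg (X z) * s2 (Y (f z)))%:E)%E.
have FI (s1 s2 : R -> R) : measurable_fun setT s1 -> measurable_fun setT s2 ->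
    (forall a, 0 <= s1 a) -> (forall a, 0 <= s2 a) ->
    P.-integrable setT (fun omega => (s1 (Y omega))%:E) ->
    P.-integrable setT (fun omega => (s2 (Y omega))%:E) ->
    law.-integrable setT (F s1 s2) /\ (\int[law]_z F s1 s2 z =
      (\int[law]_z (pos (X z))%:E) * \int[P]_omega (s1 (Y omega))%:E +
      (\int[law]_z (neg (X z))%:E) * \int[P]_omega (s2 (Y omega))%:E)%E.
  move=> ms1 ms2 s10 s20 is1 is2.
  have i1 := prodI pos s1 mpos ms1 pos0 s10 iXp is1.
  have i2 := prodI neg s2 mneg ms2 neg0 s20 iXn is2.
  by split; [exact: integrableD|rewrite integralD // !prodE].
have [i1 e1] := FI pos neg mpos mneg pos0 neg0 iYp iYn.
have [i2 e2] := FI neg pos mneg mpos neg0 pos0 iYn iYp.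
transitivity (\int[law]_z (F pos neg z - F neg pos z))%E.
  apply: eq_integral => z _; rewrite -[g _ _]/(X z) -[w j (f z) l 0]/(Y (f z)).
  rewrite /F -!EFinD; congr EFin.
  by rewrite {1}(posneg (X z)) {1}(posneg (Y (f z))); ring.
rewrite integralB // e1 e2 Ypn subee //.
by rewrite fin_numD !fin_numM // integrable_fin_num.
Qed.

End closed_loop.

(** * The expected cost *)

Section square_integrable.
Context d (Z : measurableType d) (R : realType) (nu : probability Z R).
Implicit Types (f g : Z -> R) (m n : nat).

Definition square_integrable f :=
  measurable_fun setT f /\ nu.-integrable setT (fun z => (f z ^+ 2)%:E).

Lemma square_integrable_dominated f g : measurable_fun setT f ->
  nu.-integrable setT (fun z => (g z)%:E) -> (forall z, f z ^+ 2 <= g z) ->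
  square_integrable f.
Proof.
move=> mf ig fg; split=> //; apply: (le_integrable measurableT _ _ ig) => //.
  by apply/measurable_EFinP; exact: measurable_funX.
move=> z _; rewrite /= lee_fin ger0_norm ?sqr_ge0 //.
by rewrite (le_trans (fg z)) // ler_norm.
Qed.

Lemma square_integrableD f g : square_integrable f -> square_integrable g ->
  square_integrable (fun z => f z + g z).
Proof.
move=> [mf if_] [mg ig].
apply: (@square_integrable_dominated _
  (fun z => 2 * (f z ^+ 2) + 2 * (g z ^+ 2))).
- exact: measurable_funD.
- have i2 h : nu.-integrable setT (fun z => (h z ^+ 2)%:E) ->
      nu.-integrable setT (fun z => (2 * h z ^+ 2)%:E).
    by move=> ih; under eq_fun do rewrite EFinM; exact: integrableZl.
  by under eq_fun do rewrite EFinD; apply: integrableD => //; exact: i2.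
- by move=> z; have := sqr_ge0 (f z - g z); nra.
Qed.

Lemma square_integrableZ c f : square_integrable f ->
  square_integrable (fun z => c * f z).
Proof.
move=> [mf if_]; split; first exact: measurable_funM.
under eq_fun do rewrite exprMn EFinM.
exact: integrableZl.
Qed.

Lemma square_integrable_cst c : square_integrable (fun=> c).
Proof.
split; first exact: measurable_cst.
exact: finite_measure_integrable_cst.
Qed.

Lemma square_integrable_sum (I : Type) (r : seq I) (Q : pred I)
    (F : I -> Z -> R) :
  (forall i, Q i -> square_integrable (F i)) ->
  square_integrable (fun z => \sum_(i <- r | Q i) F i z).
Proof.
move=> hF; elim: r => [|i r IH].
  by under eq_fun do rewrite big_nil; exact: square_integrable_cst.
under eq_fun do rewrite big_cons.
by case Qi: (Q i) => //; apply: square_integrableD => //; exact: hF.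
Qed.

Lemma square_integrableM f g : square_integrable f -> square_integrable g ->
  nu.-integrable setT (fun z => (f z * g z)%:E).
Proof.
move=> [mf if_] [mg ig].
apply: (@le_integrable _ _ _ nu _ measurableT _
  (fun z => (f z ^+ 2)%:E + (g z ^+ 2)%:E)%E).
- by apply/measurable_EFinP; exact: measurable_funM.
- move=> z _; rewrite -EFinD /= lee_fin [leRHS]ger0_norm ?addr_ge0 ?sqr_ge0 //.
  rewrite ler_norml.
  have := sqr_ge0 (f z - g z); have := sqr_ge0 (f z + g z).
  by move=> h1 h2; apply/andP; split; nra.
- exact: integrableD.
Qed.

Definition vec_square_integrable n (X : Z -> 'cV[R]_n) :=
  forall k, square_integrable (fun z => X z k 0).

Lemma vec_square_integrable_cst n (x : 'cV[R]_n) :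
  vec_square_integrable (fun=> x).
Proof. by move=> k; exact: square_integrable_cst. Qed.

Lemma vec_square_integrableD n (X Y : Z -> 'cV[R]_n) :
  vec_square_integrable X -> vec_square_integrable Y ->
  vec_square_integrable (fun z => X z + Y z).
Proof.
by move=> hX hY k; under eq_fun do rewrite mxE; exact: square_integrableD.
Qed.

Lemma vec_square_integrable_mulmx m n (A : 'M[R]_(m, n)) (X : Z -> 'cV[R]_n) :
  vec_square_integrable X -> vec_square_integrable (fun z => A *m X z).
Proof.
move=> hX k; under eq_fun do rewrite mxE.
by apply: square_integrable_sum => l _; exact: square_integrableZ.
Qed.

Lemma vec_square_integrable_sum n (I : Type) (r : seq I) (Q : pred I)
    (X : I -> Z -> 'cV[R]_n) :
  (forall i, Q i -> vec_square_integrable (X i)) ->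
  vec_square_integrable (fun z => \sum_(i <- r | Q i) X i z).
Proof.
move=> hX k; under eq_fun do rewrite summxE.
by apply: square_integrable_sum => i Qi; exact: hX.
Qed.

Lemma integrable_sumr (I : Type) (r : seq I) (Q : pred I) (F : I -> Z -> R) :
  (forall i, Q i -> nu.-integrable setT (fun z => (F i z)%:E)) ->
  nu.-integrable setT (fun z => (\sum_(i <- r | Q i) F i z)%:E).
Proof.
move=> hF; elim: r => [|i r IH].
  by under eq_fun do rewrite big_nil; exact: finite_measure_integrable_cst.
under eq_fun do rewrite big_cons.
case Qi: (Q i) => //; under eq_fun do rewrite EFinD.
by apply: integrableD => //; exact: hF.
Qed.

Lemma integrable_dot n (X Y : Z -> 'cV[R]_n) :
  vec_square_integrable X -> vec_square_integrable Y ->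
  nu.-integrable setT (fun z => (dot (X z) (Y z))%:E).
Proof.
move=> hX hY; under eq_fun do rewrite dotE.
by apply: integrable_sumr => k _; exact: square_integrableM.
Qed.

Lemma integrable_quad n (M : 'M[R]_n) (X : Z -> 'cV[R]_n) :
  vec_square_integrable X -> nu.-integrable setT (fun z => (quad M (X z))%:E).
Proof.
move=> hX; under eq_fun do rewrite quadE.
by apply: integrable_dot => //; exact: vec_square_integrable_mulmx.
Qed.

Definition centered f :=
  nu.-integrable setT (fun z => (f z)%:E) /\ (\int[nu]_z (f z)%:E = 0)%E.

Lemma centeredZ c f : centered f -> centered (fun z => c * f z).
Proof.
move=> [if_ f0]; split.
  by under eq_fun do rewrite EFinM; exact: integrableZl.
by under eq_integral do rewrite EFinM; rewrite integralZl // f0 mule0.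
Qed.

Lemma centered_sum (I : Type) (r : seq I) (Q : pred I) (F : I -> Z -> R) :
  (forall i, Q i -> centered (F i)) ->
  centered (fun z => \sum_(i <- r | Q i) F i z).
Proof.
move=> hF; elim: r => [|i r [IHi IH0]].
  split; first by under eq_fun do rewrite big_nil;
    exact: finite_measure_integrable_cst.
  by rewrite integral0_eq // => z _; rewrite big_nil.
split.
  under eq_fun do rewrite big_cons.
  case Qi: (Q i) => //; under eq_fun do rewrite EFinD.
  by apply: integrableD => //; case: (hF i Qi).
under eq_integral do rewrite big_cons.
case Qi: (Q i) => //; under eq_integral do rewrite EFinD.
by have [iF F0] := hF i Qi; rewrite integralD // F0 IH0 adde0.
Qed.

Lemma centered_dot_mulmx m n (A : 'M[R]_(m, n)) (X : Z -> 'cV[R]_m)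
    (Y : Z -> 'cV[R]_n) :
  (forall k l, centered (fun z => X z k 0 * Y z l 0)) ->
  centered (fun z => dot (X z) (A *m Y z)).
Proof.
move=> hXY.
have -> : (fun z => dot (X z) (A *m Y z)) =
   (fun z => \sum_k \sum_l A k l * (X z k 0 * Y z l 0)).
  apply/funext => z; rewrite dotE; apply: eq_bigr => k _.
  by rewrite mxE mulr_sumr; apply: eq_bigr => l _; rewrite mulrCA.
by apply: centered_sum => k _; apply: centered_sum => l _; exact: centeredZ.
Qed.

End square_integrable.

Section lqr_policy.
Variables (R : realType) (nx nu nw : nat) (D : lq_data R nx nu nw) (T p : nat).

Definition lqr_policy : policy R nx nu nw T p :=
  fun t => kdirac (@measurable_lqr_action R nx nu nw D T p t).

Lemma lqr_policyE t i :
  lqr_policy t i = \d_(lqr_action D i) :> (set 'cV[R]_nu -> \bar R).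
Proof. by []. Qed.

Hypothesis hQ : forall t, (t <= T)%N -> sym_psd (lq_Q D t).
Hypothesis hR : forall t, (t < T)%N -> sym_pd (lq_R D t).

Lemma cost_ge0 x0 w u : 0 <= cost D T x0 w u.
Proof.
apply: addr_ge0; first by have [_] := hQ (leqnn T); exact.
apply: sumr_ge0 => t _; apply: addr_ge0.
  by have [_] := hQ (ltnW (ltn_ord t)); exact.
by have [_] := sym_pd_psd (hR (ltn_ord t)); exact.
Qed.

Lemma input_le_cost x0 w u t : (t < T)%N ->
  quad (lq_R D t) (u t) <= cost D T x0 w u.
Proof.
move=> tT; rewrite /cost (bigD1 (Ordinal tT)) //=.
have h0 : 0 <= quad (lq_Q D T) (state D x0 w u T).
  by have [_] := hQ (leqnn T); exact.
have h1 : 0 <= quad (lq_Q D t) (state D x0 w u t).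
  by have [_] := hQ (ltnW tT); exact.
have : 0 <= \sum_(i < T | i != Ordinal tT)
    (quad (lq_Q D i) (state D x0 w u i) + quad (lq_R D i) (u i)).
  apply: sumr_ge0 => i _; apply: addr_ge0.
    by have [_] := hQ (ltnW (ltn_ord i)); exact.
  by have [_] := sym_pd_psd (hR (ltn_ord i)); exact.
lra.
Qed.

Lemma offline_cost_closed_loop x0 w u :
  (forall t, (t < T)%N -> deviation D T p x0 w u t = 0) ->
  cost D T x0 w u = offline_cost D T p x0 w.
Proof.
move=> dev0; rewrite (cost_decomposition p hQ hR).
rewrite !big1 ?mul0rn ?addr0 // => t _; rewrite dev0 // ?quad0 //.
by rewrite dotC dot0r.
Qed.

(** Along each path V is the cost incurred by the claimed policy, whose actions [draw_dirac]
    supplies. The formula does not show the sign, as [step_const] contains a negative term. *)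
Lemma offline_cost_ge0 x0 w : 0 <= offline_cost D T p x0 w.
Proof.
have [u [_ dev0 _]] := @draw_dirac _ _ _ _ D T p lqr_policy x0 w T 0 (fun=> 0)
  (leqnn _) (fun s i _ => lqr_policyE i).
rewrite -(offline_cost_closed_loop (u := u)); first exact: cost_ge0.
by move=> t tT; exact: dev0.
Qed.

End lqr_policy.

(** * Expected cost restricted to an event of sigma(i_0) *)

Section closed_loop_cost.
Variables (R : realType) (nx nu nw : nat) (D : lq_data R nx nu nw) (T p : nat).
Variables (K : policy R nx nu nw T p) (x0 : 'cV[R]_nx).
Context d (Omega : measurableType d) (P : probability Omega R).
Variable w : nat -> {RV P >-> 'cV[R]_nw}.
Hypothesis hQ : forall t, (t <= T)%N -> sym_psd (lq_Q D t).
Hypothesis hR : forall t, (t < T)%N -> sym_pd (lq_R D t).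
Hypothesis indep : mutually_independent T w.
Hypotheses (hmean : zero_mean T w) (hcov : identity_covariance T w).

Lemma vec_square_integrable_noise j : (j < T)%N ->
  vec_square_integrable P (w j).
Proof.
move=> jT k.
have mwk : measurable_fun setT (fun omega => w j omega k 0).
  by have /measurable_matrixP := @measurable_noise _ _ _ _ _ w j; exact.
split=> //; apply/integrableP; split.
  by apply/measurable_EFinP; exact: measurable_funX.
have := hcov jT jT k k; rewrite unlock => h.
under eq_integral do rewrite gee0_abs ?lee_fin ?sqr_ge0 //.
apply: le_lt_trans (ltry ((j == j)%:R * (1%:M : 'M[R]_nw) k k)).
rewrite -h le_eqVlt; apply/orP; left; apply/eqP.
by apply: eq_integral => omega _; rewrite mxE big_ord1 mxE expr2.
Qed.

Lemma integrable_offline_cost :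
  P.-integrable setT
    (fun omega => (offline_cost D T p x0 (noise_path w omega))%:E).
Proof.
have hcostate t : vec_square_integrable P
    (fun omega => costate D T (noise_path w omega) t).
  under eq_fun do rewrite /costate big_seq.
  apply: vec_square_integrable_sum => j; rewrite mem_index_iota => /andP[_ jT].
  exact/vec_square_integrable_mulmx/vec_square_integrable_noise.
have htail t : vec_square_integrable P
    (fun omega => costate_tail D T p (noise_path w omega) t).
  under eq_fun do rewrite /costate_tail big_seq.
  apply: vec_square_integrable_sum => j; rewrite mem_index_iota => /andP[_ jT].
  exact/vec_square_integrable_mulmx/vec_square_integrable_noise.
have id2 (f : Omega -> R) : P.-integrable setT (fun z => (f z)%:E) ->
    P.-integrable setT (fun z => (f z *+ 2)%:E).
  by move=> hf; under eq_fun do rewrite mulr2n EFinD; exact: integrableD.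
under eq_fun do rewrite /offline_cost 2!EFinD.
apply: integrableD => //; first apply: integrableD => //.
- exact: finite_measure_integrable_cst.
- by apply/id2/integrable_dot => //; exact: vec_square_integrable_cst.
apply: integrable_sumr => t _; under eq_fun do rewrite EFinD.
have hw := vec_square_integrable_noise (ltn_ord t).
have hbw : vec_square_integrable P
    (fun omega => lq_Bw D t *m noise_path w omega t).
  exact: vec_square_integrable_mulmx.
apply: integrableD => //; last first.
  by apply: integrable_quad; exact: vec_square_integrable_mulmx.
have hg : vec_square_integrable P (fun omega => (lq_Bu D t)^T *m
   (riccati D T t.+1 *m (lq_Bw D t *m noise_path w omega t)
     + costate D T (noise_path w omega) t.+1)).
  apply: vec_square_integrable_mulmx; apply: vec_square_integrableD => //.
  exact: vec_square_integrable_mulmx.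
under eq_fun do rewrite /step_const EFinB EFinD.
apply: integrableB => //; last first.
  by apply: integrable_dot => //; exact: vec_square_integrable_mulmx.
apply: integrableD => //; first exact: integrable_quad.
exact/id2/integrable_dot.
Qed.

Context d' (Z : measurableType d') (law : probability Z R).
Variables (f : Z -> Omega) (v : Z -> nat -> 'cV[R]_nu).
Hypotheses (mf : measurable_fun setT f) (mv : path_measurable v).
Hypothesis lawE : forall F : Omega -> (nat -> 'cV[R]_nu) -> \bar R,
  (forall s u, 0 <= F s u)%E -> jointly_measurable F ->
  policy_expectation D w x0 K F = (\int[law]_z F (f z) (v z))%E.

Local Notation W := (fun z => noise_path w (f z)).

Lemma measurable_noise_path : path_measurable (noise_path w).
Proof. by move=> t; exact: measurable_noise. Qed.

Lemma measurable_law_noise : path_measurable W.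
Proof. by move=> t; apply: measurableT_comp mf; exact: measurable_noise. Qed.

(** The image of [law] under [f] is P: a function that ignores the actions passes unchanged through
    all draws. *)
Lemma ge0_integral_law_fst (G : Omega -> R) :
  measurable_fun setT G -> (forall omega, 0 <= G omega) ->
  (\int[law]_z (G (f z))%:E = \int[P]_omega (G omega)%:E)%E.
Proof.
move=> mG G0; rewrite -(@lawE (fun omega _ => (G omega)%:E)).
- by apply: eq_integral => omega _; rewrite draw_future.
- by move=> s u; rewrite lee_fin.
- move=> d1 S1 f1 u1 mf1 _; apply/measurable_EFinP; exact: measurableT_comp.
Qed.

Lemma vec_square_integrable_law_noise j : (j < T)%N ->
  vec_square_integrable law (fun z => W z j).
Proof.
move=> jT k; have [mw iw] := vec_square_integrable_noise jT k.
have mw2 : measurable_fun setT (fun omega => (w j omega k 0 ^+ 2)).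
  exact: measurable_funX.
split; first exact: (measurableT_comp mw mf).
apply/integrableP; split.
  by apply/measurable_EFinP; exact: (measurableT_comp mw2 mf).
under eq_integral do rewrite gee0_abs ?lee_fin ?sqr_ge0 //.
rewrite (@ge0_integral_law_fst (fun omega => w j omega k 0 ^+ 2)) //;
  last by move=> omega; exact: sqr_ge0.
by rewrite ltey_eq integrable_fin_num.
Qed.

Variable B : set (info R nx nw T p 0).
Hypothesis mB : measurable B.

(** The event is described by a set [B] of values of i_0, which exhibits its indicator as a function
    of the disturbances visible at time 0; the independence argument relies on this form. *)
Definition event0 (omega : Omega) : R :=
  \1_B (info_at D T p x0 (noise_path w omega) (fun=> 0) 0).

Lemma measurable_event0 : measurable_fun setT event0.
Proof.
apply: (measurableT_comp (measurable_indic mB)).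
by apply: measurable_info_at => [|t]; [exact: measurable_noise_path|
  exact: measurable_cst].
Qed.

Lemma event0_ge0 omega : 0 <= event0 omega.
Proof. by rewrite /event0 indicE; case: (_ \in _). Qed.

Lemma event0_sqr omega : event0 omega ^+ 2 = event0 omega.
Proof.
by rewrite /event0 indicE expr2; case: (_ \in _); rewrite ?mulr1 ?mulr0.
Qed.

Let chi z := event0 (f z).

Let mchi : measurable_fun setT chi.
Proof. exact: measurableT_comp measurable_event0 mf. Qed.

Lemma square_integrable_event (g : Z -> R) : square_integrable law g ->
  square_integrable law (fun z => chi z * g z).
Proof.
move=> [mg ig]; apply: square_integrable_dominated ig _.
  exact: measurable_funM.
move=> z; rewrite exprMn /chi /event0 indicE; case: (_ \in _).
  by rewrite expr1n mul1r.
by rewrite expr0n mul0r sqr_ge0.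
Qed.

Lemma vec_square_integrable_event n (X : Z -> 'cV[R]_n) :
  vec_square_integrable law X ->
  vec_square_integrable law (fun z => chi z *: X z).
Proof.
by move=> hX k; under eq_fun do rewrite mxE; exact: square_integrable_event.
Qed.

Hypothesis fin : (\int[law]_z (chi z * cost D T x0 (W z) (v z))%:E < +oo)%E.

Let mcost : measurable_fun setT (fun z => cost D T x0 (W z) (v z)).
Proof. apply: measurable_cost => //; exact: measurable_law_noise. Qed.

Lemma integrable_event_cost :
  law.-integrable setT (fun z => (chi z * cost D T x0 (W z) (v z))%:E).
Proof.
apply/integrableP; split.
  by apply/measurable_EFinP; exact: measurable_funM.
under eq_integral do
  rewrite gee0_abs ?lee_fin ?mulr_ge0 ?event0_ge0 ?cost_ge0 //.
exact: fin.
Qed.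

Lemma vec_square_integrable_input t : (t < T)%N ->
  vec_square_integrable law (fun z => chi z *: v z t).
Proof.
move=> tT k; under eq_fun do rewrite mxE.
have [C hC] : exists C, forall u : 'cV[R]_nu,
    u k 0 ^+ 2 <= C * quad (lq_R D t) u.
  by eexists => u; exact: quad_pd_coord_le (hR tT).
have mvk : measurable_fun setT (fun z => v z t k 0).
  by have /measurable_matrixP := mv t; exact.
apply: (@square_integrable_dominated _ _ _ _ _
  (fun z => `|C| * (chi z * cost D T x0 (W z) (v z)))).
- exact: measurable_funM.
- under eq_fun do rewrite EFinM.
  by apply: integrableZl => //; exact: integrable_event_cost.
- move=> z; rewrite exprMn [chi z ^+ 2]event0_sqr [leRHS]mulrCA.
  apply: ler_wpM2l; first exact: event0_ge0.
  apply: (le_trans (hC _)).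
  have q0 : 0 <= quad (lq_R D t) (v z t).
    by have [_] := sym_pd_psd (hR tT); exact.
  apply: (@le_trans _ _ (`|C| * quad (lq_R D t) (v z t))).
    by rewrite ler_wpM2r // ler_norm.
  by rewrite ler_wpM2l // (input_le_cost hQ hR).
Qed.

(** Q_t is only semidefinite, so the cost need not bound the state; square integrability is
    propagated from inputs and noise through the dynamics. *)
Lemma vec_square_integrable_state t : (t <= T)%N ->
  vec_square_integrable law (fun z => chi z *: state D x0 (W z) (v z) t).
Proof.
elim: t => [|t IH] tT /=.
  by apply: vec_square_integrable_event; exact: vec_square_integrable_cst.
under eq_fun do rewrite !scalerDr !scalemxAr.
apply: vec_square_integrableD; last first.
  apply/vec_square_integrable_mulmx/vec_square_integrable_event.
  exact: vec_square_integrable_law_noise.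
apply: vec_square_integrableD; apply: vec_square_integrable_mulmx.
  exact/IH/ltnW.
exact: vec_square_integrable_input.
Qed.

Local Notation dev z t := (deviation D T p x0 (W z) (v z) t).

Lemma vec_square_integrable_info_w t j :
  vec_square_integrable law
    (fun z => info_w (info_at D T p x0 (W z) (v z) t) j).
Proof.
under eq_fun do rewrite info_w_at.
case jm: (j < minn (t + p).+1 T)%N; last exact: vec_square_integrable_cst.
move: jm; rewrite leq_min => /andP[_ jT].
exact: vec_square_integrable_law_noise.
Qed.

Lemma vec_square_integrable_deviation t : (t < T)%N ->
  vec_square_integrable law (fun z => chi z *: dev z t).
Proof.
move=> tT.
have -> : (fun z => chi z *: dev z t) = (fun z => chi z *: v z t +
    (gain_x D T t *m (chi z *: state D x0 (W z) (v z) t) +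
     chi z *: (gain_w D T t *m info_w (info_at D T p x0 (W z) (v z) t) t +
       gain_v D T t *m preview_v D (info_at D T p x0 (W z) (v z) t)))).
  apply/funext => z; rewrite /deviation /lqr_action info_x_at !opprD !opprK.
  by rewrite -scalemxAr -!scalerDr !addrA.
apply: vec_square_integrableD; first exact: vec_square_integrable_input.
apply: vec_square_integrableD.
  apply: vec_square_integrable_mulmx.
  exact/vec_square_integrable_state/ltnW.
apply/vec_square_integrable_event/vec_square_integrableD.
  exact/vec_square_integrable_mulmx/vec_square_integrable_info_w.
apply: vec_square_integrable_mulmx; apply: vec_square_integrable_sum => j _.
exact/vec_square_integrable_mulmx/vec_square_integrable_info_w.
Qed.

(** The restricted deviation is a causal function of w_0, ..., w_{t+p} and u_0, ..., u_t, hence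
    orthogonal to later disturbances by [integral_law_noise_eq0]. *)
Lemma centered_deviation_noise t j k l : (t + p < j < T)%N ->
  centered law (fun z => (chi z *: dev z t) k 0 * W z j l 0).
Proof.
move=> /[dup] tpjT /andP[tpj jT].
have tT : (t < T)%N.
  apply: leq_trans jT; rewrite ltnS ltnW //.
  exact: leq_ltn_trans (leq_addr _ _) tpj.
have hdev := vec_square_integrable_deviation tT.
split.
  apply: square_integrableM; first exact: hdev.
  exact: vec_square_integrable_law_noise.
pose path (x : (t + p).+1.-tuple 'cV[R]_nw) i := nth 0 x i.
have mpath : path_measurable path by exact: path_measurable_nth.
have pathE omega i : (i < (t + p).+1)%N -> path (past w _ omega) i = w i omega.
  by move=> iq; rewrite /path -(tnth_nth 0 _ (Ordinal iq)) tnth_mktuple.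
(* The same expression on the path cut to zero beyond t + p; neither i_0 nor i_t reads further, so
   [gE] recovers the original. *)
pose g (x : (t + p).+1.-tuple 'cV[R]_nw) (u : nat -> 'cV[R]_nu) : R :=
  \1_B (info_at D T p x0 (path x) (fun=> 0) 0) *
  deviation D T p x0 (path x) u t k 0.
have gE z : g (past w _ (f z)) (v z) = (chi z *: dev z t) k 0.
  have e1 : info_at D T p x0 (path (past w _ (f z))) (fun=> 0) 0 =
      info_at D T p x0 (W z) (fun=> 0) 0.
    apply: info_at_congr => // i; rewrite leq_min => /andP[ip _].
    by rewrite pathE // (leq_trans ip) // ltnS leq_add2r.
  have e2 : deviation D T p x0 (path (past w _ (f z))) (v z) t = dev z t.
    congr (_ - lqr_action D _); apply: info_at_congr => // [|i].
      exact: ltnW.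
    by rewrite leq_min => /andP[ip _]; rewrite pathE.
  by rewrite /g e1 e2 [RHS]mxE.
under eq_integral do rewrite -gE.
apply: (integral_law_noise_eq0 (g := g) indep mf lawE tpjT).
- move=> x u u' uu'; rewrite /g /deviation uu' //.
  suff -> : info_at D T p x0 (path x) u t =
    info_at D T p x0 (path x) u' t by [].
  apply: info_at_congr => // [|s st]; first exact: ltnW.
  by rewrite uu' // ltnW.
- move=> d1 S1 f1 u1 mf1 mu1; apply/measurable_EFinP.
  have mp1 : path_measurable (fun s => path (f1 s)).
    by move=> i; exact: (measurableT_comp (mpath i) mf1).
  apply: measurable_funM.
    apply: (measurableT_comp (measurable_indic mB)).
    by apply: measurable_info_at => // i; exact: measurable_cst.
  have := measurable_deviation D T p x0 t mp1 mu1.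
  by move/measurable_matrixP; exact.
- under eq_fun do rewrite gE -[_ k 0]mulr1.
  by apply: square_integrableM; [exact: hdev|exact: square_integrable_cst].
- under eq_fun do rewrite -[w j _ l 0]mulr1.
  apply: square_integrableM; last exact: square_integrable_cst.
  exact: (vec_square_integrable_noise jT).
- by have := hmean jT l; rewrite unlock.
Qed.

Lemma centered_cross_term t : (t < T)%N ->
  centered law (fun z => chi z *
    dot (dev z t) ((lq_Bu D t)^T *m costate_tail D T p (W z) t)).
Proof.
move=> tT; under eq_fun do rewrite -dotZl.
rewrite /costate_tail.
(* The range is repeated as a filter so that [centered_sum] hands over the bounds on j. *)
have -> : (fun z => dot (chi z *: dev z t) ((lq_Bu D t)^T *m
   \sum_((t + p).+1 <= j < T) (\prod_(t.+1 <= l < j.+1) (Ahat D T l)^T)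
      *m riccati D T j.+1 *m lq_Bw D j *m W z j)) =
  (fun z => \sum_(j <- index_iota (t + p).+1 T | j \in index_iota (t + p).+1 T)
    dot (chi z *: dev z t) ((lq_Bu D t)^T *m
    ((\prod_(t.+1 <= l < j.+1) (Ahat D T l)^T)
      *m riccati D T j.+1 *m lq_Bw D j) *m W z j)).
  apply/funext => z; rewrite mulmx_sumr -big_seq.
  elim/big_rec2: _ => [|j y x _ <-]; first by rewrite dot0r.
  by rewrite dotDr !mulmxA.
apply: centered_sum => j; rewrite mem_index_iota => jT.
by apply: centered_dot_mulmx => k l; exact: centered_deviation_noise.
Qed.

(** The centered cross term can be subtracted from the integrable cost without changing the
    integral. What remains is a sum of two nonnegative functions, whose integrals add; the one with
    V sees the disturbances only and is moved back to P. *)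
Lemma expected_cost_decomposition :
  (\int[law]_z (chi z * cost D T x0 (W z) (v z))%:E =
   \int[P]_omega
     (event0 omega * offline_cost D T p x0 (noise_path w omega))%:E +
   \int[law]_z (chi z * \sum_(t < T) quad (Hmx D T t) (dev z t))%:E)%E.
Proof.
pose cross z := \sum_(t < T)
  chi z * dot (dev z t) ((lq_Bu D t)^T *m costate_tail D T p (W z) t).
have hcross : centered law (fun z => 2 * cross z).
  by apply/centeredZ/centered_sum => t _; exact: centered_cross_term.
have mV : measurable_fun setT
    (fun omega => offline_cost D T p x0 (noise_path w omega)).
  by have /measurable_int/measurable_EFinP := integrable_offline_cost.
have chi0 z : 0 <= chi z := event0_ge0 _.
have mS : measurable_fun setT
    (fun z => \sum_(t < T) quad (Hmx D T t) (dev z t)).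
  apply: measurable_sum => t; apply/measurable_quad/measurable_deviation => //.
  exact: measurable_law_noise.
have S0 z : 0 <= \sum_(t < T) quad (Hmx D T t) (dev z t).
  apply: sumr_ge0 => t _.
  by have [_] := sym_pd_psd (Hmx_pd hQ hR (ltn_ord t)); exact.
rewrite -(ge0_integral_law_fst (G := fun omega =>
    event0 omega * offline_cost D T p x0 (noise_path w omega))); last 2 first.
- by apply: measurable_funM => //; exact: measurable_event0.
- by move=> omega; rewrite mulr_ge0 ?event0_ge0 ?offline_cost_ge0.
rewrite -ge0_integralD //; first last.
- by apply/measurable_EFinP; exact: measurable_funM.
- by move=> z _; rewrite lee_fin mulr_ge0.
- apply/measurable_EFinP; apply: measurable_funM => //.
  exact: (measurableT_comp mV mf).
- by move=> z _; rewrite lee_fin mulr_ge0 ?offline_cost_ge0.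
have [ic c0] := hcross.
transitivity (\int[law]_z ((chi z * cost D T x0 (W z) (v z))%:E -
    (2 * cross z)%:E))%E.
  by rewrite integralB // ?c0 ?sube0 //; exact: integrable_event_cost.
apply: eq_integral => z _; rewrite -EFinB -EFinD; congr EFin.
rewrite (cost_decomposition p hQ hR) /cross -mulr_sumr mulr2n; ring.
Qed.

End closed_loop_cost.

(** * Conditional costs and optimality *)

Section conditional_expectation.
Context d d' (Omega : measurableType d) (Y : measurableType d') (R : realType).
Variables (P : probability Omega R) (X : Omega -> Y) (V : Omega -> \bar R).
Hypotheses (mX : measurable_fun setT X) (iV : P.-integrable setT V).

Let mpre B : measurable B -> measurable (X @^-1` B).
Proof. by move=> mB; rewrite -[X in measurable X]setTI; exact: mX. Qed.

(** Built on [Y] rather than on a sub-sigma-algebra of [Omega]: a density is then a function of [X],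
    so the conditional expectation is sigma(X)-measurable by its form. *)
Definition image_charge (B : set Y) : \bar R := induced_charge iV (X @^-1` B).

Let image_charge0 : image_charge set0 = 0%E.
Proof. by rewrite /image_charge preimage_set0 charge0. Qed.

Let image_charge_fin B : measurable B -> image_charge B \is a fin_num.
Proof. by move=> mB; apply: fin_num_measure; exact: mpre. Qed.

Let image_charge_sigma_additive : semi_sigma_additive image_charge.
Proof.
move=> F mF tF mUF; rewrite /image_charge preimage_bigcup.
apply: charge_semi_sigma_additive.
- by move=> n; exact: mpre.
- apply/trivIsetP => i j _ _ ij; rewrite -preimage_setI.
  by move/trivIsetP : tF => /(_ _ _ _ _ ij) -> //; rewrite preimage_set0.
- by rewrite -preimage_bigcup; exact: mpre.
Qed.

HB.instance Definition _ := isCharge.Build _ _ _ image_charge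
  image_charge0 image_charge_fin image_charge_sigma_additive.

Lemma conditional_expectation_exists : exists phi : Y -> \bar R,
  [/\ measurable_fun setT phi, forall y, phi y \is a fin_num,
      P.-integrable setT (phi \o X) &
      forall B, measurable B ->
        (\int[P]_(omega in X @^-1` B) V omega =
         \int[P]_(omega in X @^-1` B) phi (X omega))%E].
Proof.
pose X' : {RV P >-> Y} := mfun_Sub (mem_set mX).
pose m := distribution P X'.
have dom : image_charge `<< m.
  apply/null_content_dominatesP => /= A mA mA0.
  apply: null_set_integral; first exact: mpre.
  - exact/measurable_funTS/(measurable_int _ iV).
  - exact: mA0.
have [phi [phifin iphi phiE]] : exists phi : Y -> \bar R,
    [/\ forall y, phi y \is a fin_num, m.-integrable setT phi &
     forall B, measurable B -> image_charge B = (\int[m]_(x in B) phi x)%E].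
  exists (Radon_Nikodym image_charge m); split.
  - by move=> y; exact: Radon_Nikodym_fin_num.
  - exact: Radon_Nikodym_integrable.
  - by move=> B mB; exact: Radon_Nikodym_integral.
have mphi : measurable_fun setT phi := measurable_int _ iphi.
have iphiX : P.-integrable setT (phi \o X).
  apply/integrableP; split; first exact: measurableT_comp.
  have /integrableP[_] := iphi.
  rewrite ge0_integral_distribution //; exact: measurableT_comp.
exists phi; split=> // B mB.
transitivity (image_charge B); first by [].
rewrite phiE // /m /distribution integral_pushforward //.
by apply: (integrableS measurableT) => //; exact: mpre.
Qed.

End conditional_expectation.

(** * Almost sure comparison through integrals *)

Section ae_comparison.
Context d (Omega : measurableType d) (R : realType) (P : probability Omega R).

(** Where h < g, rationals q1 < q2 fit in between. On E = {h <= q1, q2 <= g}, an event of [G], the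
    integrals force q2 P(E) <= q1 P(E), so P(E) = 0, and countably many pairs cover {h < g}. *)
Lemma ae_le_of_integral (G : set (set Omega)) (g h : Omega -> \bar R) :
  G `<=` measurable -> setI_closed G ->
  (forall B, measurable B -> G (g @^-1` B)) ->
  (forall B, measurable B -> G (h @^-1` B)) ->
  P.-integrable setT g -> (forall omega, g omega \is a fin_num) ->
  (forall E, G E -> \int[P]_(omega in E) g omega <=
     \int[P]_(omega in E) h omega)%E ->
  {ae P, forall omega, (g omega <= h omega)%E}.
Proof.
move=> Gm GI Gg Gh ig gfin gh.
pose E (q : rat * rat) : set Omega :=
  h @^-1` [set y | (y <= (ratr q.1)%:E)%E] `&`
  g @^-1` [set y | ((ratr q.2)%:E <= y)%E].
have mle (r : R) : measurable [set y : \bar R | (y <= r%:E)%E].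
  by have := emeasurable_itv (Interval -oo%O (BRight r%:E)); rewrite set_itvNyc.
have mge (r : R) : measurable [set y : \bar R | (r%:E <= y)%E].
  by have := emeasurable_itv (Interval (BLeft r%:E) +oo%O); rewrite set_itvcy.
have GE q : G (E q) by apply: GI; [exact/Gh/mle|exact/Gg/mge].
have mh : measurable_fun setT h.
  by move=> _ B mB; rewrite setTI; exact/Gm/Gh.
have PE q : q.1 < q.2 -> P (E q) = 0%E.
  move=> q12; have mE : measurable (E q) := Gm _ (GE q).
  have PEfin : P (E q) \is a fin_num := fin_num_measure P _ mE.
  have le1 : ((ratr q.2)%:E * P (E q) <= \int[P]_(omega in E q) g omega)%E.
    rewrite -integral_cst //; apply: le_integral => //.
    - exact: finite_measure_integrable_cst.
    - exact: (integrableS measurableT).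
    - by move=> omega; rewrite inE => -[].
  (* [h] is only bounded above on E and its integral may be -oo, hence the comparison through
     positive and negative parts. *)
  have le2 : (\int[P]_(omega in E q) h omega <= (ratr q.1)%:E * P (E q))%E.
    rewrite -integral_cst // [leLHS]integralE [leRHS]integralE; apply: leeB.
    + apply: ge0_le_integral => //.
      * by apply: measurable_funepos; exact: measurable_funTS.
      * by apply: measurable_funepos; exact: measurable_cst.
      * move=> omega [hq _]; rewrite !funeposE.
        by rewrite ge_max !le_max hq lexx !orbT.
    + apply: ge0_le_integral => //.
      * by apply: measurable_funeneg; exact: measurable_cst.
      * by apply: measurable_funeneg; exact: measurable_funTS.
      * move=> omega [hq _]; rewrite !funenegE.
        by rewrite ge_max !le_max leeN2 hq lexx !orbT.
  have := le_trans le1 (le_trans (gh _ (GE q)) le2).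
  rewrite -(fineK PEfin) -!EFinM lee_fin => le12.
  have p0 : 0 <= fine (P (E q)) by exact: fine_ge0.
  have q12' : ratr q.1 < ratr q.2 :> R by rewrite ltr_rat.
  apply/eqP; rewrite eqe eq_le p0 andbT leNgt; apply/negP => p_gt0.
  by move: le12; rewrite ler_pM2r // leNgt q12'.
(* Enumerates the rational pairs by their codes; numbers that code no pair, or a pair out of order,
   give the empty set. *)
pose F n := if unpickle n is Some q then
  (if (q : rat * rat).1 < q.2 then E q else set0) else set0.
have : P.-negligible (\bigcup_n F n).
  apply: negligible_bigcup => n; rewrite /F.
  case: unpickle => [q|]; last exact: negligible_set0.
  case: ifPn => [q12|_]; last exact: negligible_set0.
  by apply/negligibleP; [exact/Gm/GE|exact: PE].
apply: negligibleS => omega /= /negP; rewrite -ltNge => hg.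
have [r gr] : exists r, g omega = r%:E.
  by exists (fine (g omega)); rewrite fineK.
(* Where h = -oo, any real below r serves; h = +oo contradicts h < g. *)
have [s hs sr] : exists2 s : R, (h omega <= s%:E)%E & s < r.
  move: hg; rewrite gr; case: (h omega) => [s|//|_].
    by rewrite lte_fin => sr; exists s.
  by exists (r - 1); [exact: leNye|lra].
have sm : s < (s + r) / 2 by lra.
have mr : (s + r) / 2 < r by lra.
have [q1] := rat_in_itvoo sm; rewrite in_itv /= => /andP[q1s q1m].
have [q2] := rat_in_itvoo mr; rewrite in_itv /= => /andP[q2m q2r].
have q12 : q1 < q2 by rewrite -(ltr_rat R); exact: lt_trans q2m.
exists (pickle (q1, q2)); first exact: I.
rewrite /F pickleK ifT; last exact: q12.
split; first by rewrite /preimage /= (le_trans hs) // lee_fin ltW.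
by rewrite /preimage /= gr lee_fin ltW.
Qed.

End ae_comparison.

(** * Optimality and uniqueness of the preview policy *)

Section optimality.
Variables (R : realType) (nx nu nw : nat) (D : lq_data R nx nu nw) (T p : nat).
Variable x0 : 'cV[R]_nx.
Context d (Omega : measurableType d) (P : probability Omega R).
Variable w : nat -> {RV P >-> 'cV[R]_nw}.
Hypothesis hQ : forall t, (t <= T)%N -> sym_psd (lq_Q D t).
Hypothesis hR : forall t, (t < T)%N -> sym_pd (lq_R D t).
Hypothesis indep : mutually_independent T w.
Hypotheses (hmean : zero_mean T w) (hcov : identity_covariance T w).

Let i0 omega : info R nx nw T p 0 :=
  info_at D T p x0 (noise_path w omega) (fun=> 0) 0.

Let V omega : R := offline_cost D T p x0 (noise_path w omega).

Local Notation event_cost B := (fun omega u =>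
  (\1_(i0 @^-1` B) omega * cost D T x0 (noise_path w omega) u)%:E).

Let mi0 : measurable_fun setT i0.
Proof.
by apply: measurable_info_at => [|t]; [exact: measurable_noise_path|
  exact: measurable_cst].
Qed.

Let mpre B : measurable B -> measurable (i0 @^-1` B).
Proof. by move=> mB; rewrite -[X in measurable X]setTI; exact: mi0. Qed.

Lemma info0_measurableP E : info0_measurable D T p w x0 E <->
  exists2 B, measurable B & E = i0 @^-1` B.
Proof.
by split=> [[B mB <-]|[B mB ->]]; exists B => //; rewrite setTI.
Qed.

Let iV : P.-integrable setT (EFin \o V).
Proof. exact: integrable_offline_cost. Qed.

Let event0E B omega : \1_(i0 @^-1` B) omega = event0 D x0 w B omega.
Proof.
by rewrite /event0 !indicE; congr (_%:R); congr nat_of_bool.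
Qed.

Let integral_event B :
  (\int[P]_(omega in i0 @^-1` B) (V omega)%:E =
   \int[P]_omega (event0 D x0 w B omega * V omega)%:E)%E.
Proof.
rewrite integral_mkcond; apply: eq_integral => omega _.
rewrite -event0E indicE patchE.
by case: (_ \in _); rewrite ?mul1r ?mul0r.
Qed.

Lemma jointly_measurable_event_cost B :
  measurable B -> jointly_measurable (event_cost B).
Proof.
move=> mB d1 S1 f1 u1 mf1 mu1; apply/measurable_EFinP; apply: measurable_funM.
  exact: measurableT_comp (measurable_indic (mpre mB)) mf1.
apply: measurable_cost => // t.
by apply: measurableT_comp mf1; exact: measurable_noise_path.
Qed.

Lemma event_cost_ge0 B omega u : (0 <= event_cost B omega u)%E.
Proof. by rewrite lee_fin mulr_ge0 ?cost_ge0 // indicE; case: (_ \in _). Qed.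

Lemma lqr_policy_event_cost B : measurable B ->
  policy_expectation D w x0 (lqr_policy D T p) (event_cost B) =
  (\int[P]_(omega in i0 @^-1` B) (V omega)%:E)%E.
Proof.
move=> mB; rewrite integral_event; apply: eq_integral => omega _.
have [u [_ dev0 ->]] := @draw_dirac _ _ _ _ D T p (lqr_policy D T p) x0
  (noise_path w omega) T 0 (fun=> 0) (leqnn _) (fun s i _ => lqr_policyE D i).
- rewrite event0E (@offline_cost_closed_loop _ _ _ _ D T p) //.
- exact: event_cost_ge0.
- move=> d1 S1 v1 mv1; have mc : measurable_fun setT (fun _ : S1 => omega).
    exact: measurable_cst.
  exact: (jointly_measurable_event_cost mB mc mv1).
Qed.

Lemma closed_loop_law_exists (K : policy R nx nu nw T p) :
  exists d' (Z : measurableType d') (law : probability Z R) (f : Z -> Omega)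
    (v : Z -> nat -> 'cV[R]_nu),
  [/\ measurable_fun setT f, path_measurable v &
   forall F, (forall s u, 0 <= F s u)%E -> jointly_measurable F ->
   policy_expectation D w x0 K F = (\int[law]_z F (f z) (v z))%E].
Proof.
have m0 : path_measurable (fun _ : Omega => fun _ : nat => 0 : 'cV[R]_nu).
  by move=> t; exact: measurable_cst.
exact: (draw_law_exists D K x0 T 0 P (measurable_noise_path w) m0).
Qed.

(** An infinite expected cost on the event makes the bound trivial; otherwise the decomposition
    applies, and its deviation terms are nonnegative. *)
Lemma le_event_cost (K : policy R nx nu nw T p) B : measurable B ->
  (\int[P]_(omega in i0 @^-1` B) (V omega)%:E <=
   policy_expectation D w x0 K (event_cost B))%E.
Proof.
move=> mB; have [d' [Z [law [f [v [mf mv lawE]]]]]] := closed_loop_law_exists K.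
rewrite lawE; last 2 first.
- exact: event_cost_ge0.
- exact: jointly_measurable_event_cost.
rewrite integral_event; under [leRHS]eq_integral do rewrite event0E.
have [fin|] := ltP (\int[law]_z (event0 D x0 w B (f z) *
  cost D T x0 (noise_path w (f z)) (v z))%:E)%E +oo%E; last first.
  by rewrite leye_eq => /eqP ->; exact: leey.
rewrite (expected_cost_decomposition hQ hR indep hmean hcov mf mv lawE mB fin).
apply: leeDl; apply: integral_ge0 => z _.
rewrite lee_fin mulr_ge0 ?event0_ge0 //; apply: sumr_ge0 => t _.
by have [_] := sym_pd_psd (Hmx_pd hQ hR (ltn_ord t)); exact.
Qed.

Lemma optimal_cost_exists : exists g,
  [/\ is_conditional_cost D w x0 (lqr_policy D T p) g,
      is_optimal_cost D T p w x0 g, P.-integrable setT g &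
      (\int[P]_omega g omega = \int[P]_omega (V omega)%:E)%E].
Proof.
have [phi [mphi phifin iphi phiE]] := conditional_expectation_exists mi0 iV.
have gcond : is_conditional_cost D w x0 (lqr_policy D T p) (phi \o i0).
  split=> [B mB|E /info0_measurableP[B mB ->]].
    apply/info0_measurableP; exists (phi @^-1` B); last by [].
    by rewrite -[X in measurable X]setTI; exact: mphi.
  by rewrite lqr_policy_event_cost // phiE.
exists (phi \o i0); split=> //; last by have := phiE setT measurableT.
split; first by exists (lqr_policy D T p).
move=> K h [hmeas hE].
apply: (ae_le_of_integral (G := info0_measurable D T p w x0)) => //.
- by move=> _ /info0_measurableP[B mB ->]; exact: mpre.
- move=> _ _ /info0_measurableP[B mB ->] /info0_measurableP[C mC ->].
  by apply/info0_measurableP; exists (B `&` C) => //; exact: measurableI.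
- by case: gcond.
- by move=> omega; exact: phifin.
- move=> E hEm; rewrite hE //; move: hEm => /info0_measurableP[B mB ->].
  by rewrite -[leLHS]phiE //; exact: le_event_cost.
Qed.

Lemma lqr_policy_optimal : optimal_policy D w x0 (lqr_policy D T p).
Proof. by have [g [? ? _ _]] := optimal_cost_exists; exists g. Qed.

(** An optimal [K] attains some version g of the minimum, and minimality against the claimed policy
    gives E[g] <= E[V], which is finite. So the cost of [K] has finite expectation, and its
    decomposition leaves no room for the deviation terms. *)
Lemma optimal_policy_action (K : policy R nx nu nw T p) :
  optimal_policy D w x0 K ->
  forall t, (t < T)%N ->
  policy_expectation D w x0 K (fun omega u =>
    (u t != lqr_action D (info_at D T p x0 (noise_path w omega) u t))%:R%:E)
  = 0%E.
Proof.
move=> [g [_ gmin] [gmeas gE]] t tT.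
have [g0 [g0cond _ ig0 g0E]] := optimal_cost_exists.
have gg0 := gmin _ _ g0cond.
have mg : measurable_fun setT g.
  move=> _ B mB; rewrite setTI.
  by have /info0_measurableP[C mC ->] := gmeas B mB; exact: mpre.
have gV : (\int[P]_omega g omega <= \int[P]_omega (V omega)%:E)%E.
  (* Nothing is known yet about integrability of [g], so the almost sure inequality is integrated on
     positive and negative parts separately. *)
  rewrite -g0E integralE [leRHS]integralE; apply: leeB.
    apply: ae_ge0_le_integral => //.
    - exact: measurable_funepos.
    - exact/measurable_funepos/(measurable_int _ ig0).
    - apply: filterS gg0 => omega h _; rewrite !funeposE.
      by rewrite ge_max !le_max h lexx !orbT.
  apply: ae_ge0_le_integral => //.
  - exact/measurable_funeneg/(measurable_int _ ig0).
  - exact: measurable_funeneg.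
  - apply: filterS gg0 => omega h _; rewrite !funenegE.
    by rewrite ge_max !le_max leeN2 h lexx !orbT.
have [d' [Z [law [f [v [mf mv lawE]]]]]] := closed_loop_law_exists K.
pose BT : set (info R nx nw T p 0) := setT.
have setTE : setT = i0 @^-1` BT by rewrite preimage_setT.
have gK : (\int[P]_omega g omega = \int[law]_z (event0 D x0 w BT (f z) *
    cost D T x0 (noise_path w (f z)) (v z))%:E)%E.
  rewrite gE; last first.
    by apply/info0_measurableP; exists BT; [exact: measurableT|exact: setTE].
  rewrite setTE lawE.
  - by apply: eq_integral => z _; rewrite event0E.
  - exact: event_cost_ge0.
  - by apply: jointly_measurable_event_cost; exact: measurableT.
have Vfin : (\int[P]_omega (V omega)%:E \is a fin_num)%E.
  exact: integrable_fin_num.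
have fin : (\int[law]_z (event0 D x0 w BT (f z) *
    cost D T x0 (noise_path w (f z)) (v z))%:E < +oo)%E.
  by rewrite -gK (le_lt_trans gV) // ltey_eq Vfin.
have decE := expected_cost_decomposition hQ hR indep hmean hcov mf mv lawE
  (measurableT : measurable BT) fin.
pose S z := \sum_(s < T) quad (Hmx D T s)
  (deviation D T p x0 (noise_path w (f z)) (v z) s).
have e1 omega : event0 D x0 w BT omega = 1 by rewrite /event0 indicE in_setT.
have q0 z (s : 'I_T) : 0 <= quad (Hmx D T s)
    (deviation D T p x0 (noise_path w (f z)) (v z) s).
  by have [_] := sym_pd_psd (Hmx_pd hQ hR (ltn_ord s)); exact.
have S0 z : 0 <= S z by exact: sumr_ge0.
have mS : measurable_fun setT S.
  apply: measurable_sum => s; apply/measurable_quad/measurable_deviation => //.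
  exact: path_measurable_comp (measurable_noise_path w) mf.
have intS : (\int[law]_z (S z)%:E = 0)%E.
  have S00 : (0 <= \int[law]_z (S z)%:E)%E.
    by apply: integral_ge0 => z _; rewrite lee_fin.
  apply/eqP; rewrite eq_le S00 andbT.
  move: gV; rewrite gK decE -integral_event preimage_setT.
  under [X in (_ + X <= _)%E]eq_integral do rewrite e1 mul1r.
  (* E[V] + E[S] = E[cost] <= E[V], and E[V] cancels because it is finite. *)
  by rewrite -[leRHS]adde0 leeD2lE.
have Sae : ae_eq law setT (EFin \o S) (cst 0%E).
  apply/ae_eq_integral_abs => //; first exact/measurable_EFinP.
  by rewrite -[RHS]intS; apply: eq_integral => z _; rewrite gee0_abs ?lee_fin.
have mneq_law : jointly_measurable (fun omega u => (u t !=
    lqr_action D (info_at D T p x0 (noise_path w omega) u t))%:R%:E : \bar R).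
  move=> d1 S1 f1 u1 mf1 mu1.
  have mneq : measurable_fun setT (fun s => u1 s t !=
      lqr_action D (info_at D T p x0 (noise_path w (f1 s)) (u1 s) t)).
    apply: measurable_neg; apply: measurable_mx_eq; first exact: mu1.
    apply: measurableT_comp; first exact: measurable_lqr_action.
    apply: measurable_info_at => //.
    exact: path_measurable_comp (measurable_noise_path w) mf1.
  have := measurable_fun_ifT mneq (@measurable_cst _ _ _ _ setT (1%E : \bar R))
    (@measurable_cst _ _ _ _ setT (0%E : \bar R)).
  by apply: eq_measurable_fun => s _; case: ifP.
rewrite (lawE (fun omega u => (u t !=
  lqr_action D (info_at D T p x0 (noise_path w omega) u t))%:R%:E)) //.
transitivity (\int[law]_z (cst 0%E z : \bar R))%E; last exact: integral0.
have mneq : measurable_fun setT (fun z => (v z t !=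
    lqr_action D (info_at D T p x0 (noise_path w (f z)) (v z) t))%:R%:E
    : \bar R).
  exact: (mneq_law _ _ _ _ mf mv).
apply: ae_eq_integral => //.
apply: filterS Sae => z + _ => /(_ I) /= [Sz0].
have : quad (Hmx D T t) (deviation D T p x0 (noise_path w (f z)) (v z) t) = 0.
  have /eqP := Sz0; rewrite psumr_eq0 => [/allP h|s _]; last exact: q0.
  by have /eqP := h (Ordinal tT) (mem_index_enum _).
move=> qdev0; case: eqP => // /eqP neq.
have [_ Hpos] := Hmx_pd hQ hR tT.
have dev_neq0 : deviation D T p x0 (noise_path w (f z)) (v z) t != 0.
  by rewrite subr_eq0.
by have := Hpos _ dev_neq0; rewrite qdev0 ltxx.
Qed.

End optimality.

(** Uniqueness can only hold along the closed loop: on information reached with probability zero an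
    optimal policy is unconstrained, so its kernels need not be Dirac there. *)
Theorem theorem2 (R : realType) (nx nu nw : nat) (D : lq_data R nx nu nw)
    (T p : nat) (d : measure_display) (Omega : measurableType d)
    (P : probability Omega R) (w : nat -> {RV P >-> 'cV[R]_nw})
    (x0 : 'cV[R]_nx)
    (hQ : forall t, (t <= T)%N -> sym_psd (lq_Q D t))
    (hR : forall t, (t < T)%N -> sym_pd (lq_R D t))
    (hiid : iid T w) (hmean : zero_mean T w)
    (hcov : identity_covariance T w) :
  (exists Kstar : policy R nx nu nw T p,
     (forall t (i : info R nx nw T p t), (t < T)%N ->
        Kstar t i = \d_(lqr_action D i) :> (set 'cV[R]_nu -> \bar R)) /\
     optimal_policy D w x0 Kstar) /\
  (forall K : policy R nx nu nw T p, optimal_policy D w x0 K ->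
     forall t, (t < T)%N ->
       policy_expectation D w x0 K
         (fun omega u =>
            (u t != lqr_action D (info_at D T p x0 (noise_path w omega) u t))%:R%:E)
       = 0%E).
Proof.
have [indep _] := hiid; split.
  exists (lqr_policy D T p); split; first by move=> t i _; exact: lqr_policyE.
  exact: lqr_policy_optimal.
by move=> K hK t; exact: optimal_policy_action.
Qed.
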